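(* There exist universal positive constants $c_0,c_4,c_6,c_7$ such that the following holds. Let $\varepsilon\in(0,1)$, let $\bm{a}_1,\dots,\bm{a}_N\in\mathbb{C}^D$ be i.i.d. uniform on the sphere $\{\bm{x}\in\mathbb{C}^D:\|\bm{x}\|_2=\sqrt{D}\}$ and independent of $\bm{H},\bm{Z}$. Let $\bm{\gamma}^{\natural}\in\mathbb{R}^N_+$ have support $S^{\natural}$ with $|S^{\natural}|=K$, let $\bm{Y}=\bm{A}\,\mathrm{diag}(\bm{\gamma}^{\natural})^{1/2}\bm{H}+\bm{Z}$, $\widehat{\bm{\Sigma}}_y=\frac1M\bm{Y}\bm{Y}^*$, and for $k\in[N]$ let $\mathcal{Y}_k=\sum_{1\le i,j\le D}\overline{a}_{k,i}a_{k,j}\widehat{\Sigma}_y(i,j)$. Let $S^0=\{k\in[N]:\mathcal{Y}_k>\overline{\mathcal{Y}}\}$ where $\overline{\mathcal{Y}}=\frac1N\sum_{k=1}^N\mathcal{Y}_k$. Write $\gamma^{\natural}_{\min},\gamma^{\natural}_{\max}$ for the smallest and largest entries of $\bm{\gamma}^{\natural}$ on $S^{\natural}$ and $c_\gamma=\gamma^{\natural}_{\max}/\gamma^{\natural}_{\min}$. If $$M\ge c_4\left(c_\gamma K+\frac{\sigma^2}{\gamma^{\natural}_{\min}}\right)^2\log\left(\frac{(eD)^2}{\varepsilon}\right)\quad\text{and}\quad K\le\min\left\{\frac{c_6D}{c_\gamma\log(DN)},\frac{c_7N}{c_\gamma}\right\},$$ then $\mathbb{P}(S^{\natural}\subset 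S^0)\ge1-\varepsilon-\frac{c_0}{D\sqrt{D}}$.
   Context: Model: $\bm{A}=[\bm{a}_1,\dots,\bm{a}_N]\in\mathbb{C}^{D\times N}$, $a_{k,i}$ is the $i$-th entry of $\bm{a}_k$; $\bm{H}\in\mathbb{C}^{N\times M}$ has i.i.d. $\mathcal{CN}(0,1)$ entries, $\bm{Z}\in\mathbb{C}^{D\times M}$ has i.i.d. $\mathcal{CN}(0,\sigma^2)$ entries, $\bm{H},\bm{Z}$ independent; $\widehat{\Sigma}_y(i,j)$ is the $(i,j)$ entry of $\widehat{\bm{\Sigma}}_y$; $\overline{a}$ denotes complex conjugate. *)

(* Defs.v *)
From HB Require Import structures.
From mathcomp Require Import all_boot all_order all_algebra.
From mathcomp Require Import all_classical all_reals all_analysis.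
From mathcomp Require Import complex.

Set Implicit Arguments.
Unset Strict Implicit.
Unset Printing Implicit Defensive.

Import Order.TTheory GRing.Theory Num.Theory.

Local Open Scope classical_set_scope.
Local Open Scope ring_scope.

Section Model.
Context {R : realType} {d : measure_display} {T : measurableType d}
  (P : probability T R).

Definition gen_sigma (J : finType) (X : J -> T -> R) : set (set T) :=
  <<s [set A | exists j B, measurable B /\ A = X j @^-1` B] >>.

Definition mutually_independent (I : finType) (F : I -> set (set T)) : Prop :=
  forall (J : {set I}) (E : I -> set T),
    (forall i, i \in J -> F i (E i)) ->
    P (\bigcap_(i in [set` J]) E i) = (\prod_(i in J) P (E i))%E.

Definition real_normal (X : T -> R) (m v : R) : Prop :=
  forall B : set R, measurable B ->
    P (X @^-1` B) = if v == 0 then \d_m B else normal_prob m (Num.sqrt v) B.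

(* z has the circularly-symmetric complex Gaussian law CN(0, v):
   real and imaginary parts are N(0, v/2) (their independence is required
   separately, through the global independence assumption). *)
Definition complex_normal (z : T -> R[i]) (v : R) : Prop :=
  real_normal (fun w => complex.Re (z w)) 0 (v / 2) /\
  real_normal (fun w => complex.Im (z w)) 0 (v / 2).

Definition realify (n : nat) (v : 'cV[R[i]]_n) : 'cV[R]_(n + n) :=
  col_mx (map_mx (@complex.Re R) v) (map_mx (@complex.Im R) v).

(* X (with values in R^n) is uniformly distributed on the sphere of radius r:
   it lies on the sphere a.s. and its law is invariant under every orthogonal
   transformation (the rotation-invariant probability on the sphere is unique).
   Equality of laws is expressed on Borel rectangles, which determine a law on R^n. *)
Definition uniform_sphere (n : nat) (X : T -> 'cV[R]_n) (r : R) : Prop :=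
  P [set w | \sum_(i < n) X w i 0 ^+ 2 = r ^+ 2] = 1%E /\
  forall O : 'M[R]_n, O^T *m O = 1%:M ->
    forall B : 'I_n -> set R, (forall i, measurable (B i)) ->
      P [set w | forall i, B i ((O *m X w) i 0)] =
      P [set w | forall i, B i (X w i 0)].

(* index set of the independent blocks: the vectors a_k, the real/imaginary
   parts of the entries of H, and the real/imaginary parts of the entries of Z *)
Definition block_index (D N M : nat) : finType :=
  ('I_N + (('I_N * 'I_M * bool) + ('I_D * 'I_M * bool)))%type.

Definition part (b : bool) (z : R[i]) : R :=
  if b then complex.Re z else complex.Im z.

Definition model_sigma (D N M : nat) (a : 'I_N -> T -> 'cV[R[i]]_D)
  (H : T -> 'M[R[i]]_(N, M)) (Z : T -> 'M[R[i]]_(D, M)) :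
  block_index D N M -> set (set T) :=
  fun b => match b with
  | inl k => gen_sigma (fun (p : 'I_D * bool) w => part p.2 (a k w p.1 0))
  | inr (inl (n, m, b)) => gen_sigma (fun (_ : unit) w => part b (H w n m))
  | inr (inr (i, m, b)) => gen_sigma (fun (_ : unit) w => part b (Z w i m))
  end.

Definition model (D N M : nat) (sigma : R) (a : 'I_N -> T -> 'cV[R[i]]_D)
  (H : T -> 'M[R[i]]_(N, M)) (Z : T -> 'M[R[i]]_(D, M)) : Prop :=
  [/\
      [/\ (forall k i b, measurable_fun setT (fun w => part b (a k w i 0))),
       (forall n m b, measurable_fun setT (fun w => part b (H w n m))) &
       (forall i m b, measurable_fun setT (fun w => part b (Z w i m)))],
      (forall k, uniform_sphere (fun w => realify (a k w)) (Num.sqrt D%:R)),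
      (forall n m, complex_normal (fun w => H w n m) 1),
      (forall i m, complex_normal (fun w => Z w i m) (sigma ^+ 2)) &
      mutually_independent (model_sigma a H Z)].

End Model.

Section Statistics.
Context {R : realType}.

Definition obsY (D N M : nat) (gam : 'I_N -> R) (a : 'I_N -> 'cV[R[i]]_D)
  (H : 'M[R[i]]_(N, M)) (Z : 'M[R[i]]_(D, M)) : 'M[R[i]]_(D, M) :=
  let A := \matrix_(i < D, k < N) a k i 0 in
  A *m diag_mx (\row_k (Complex (Num.sqrt (gam k)) 0)) *m H + Z.

Definition Sigma_hat (D M : nat) (Y : 'M[R[i]]_(D, M)) : 'M[R[i]]_D :=
  (M%:R)^-1 *: (Y *m (map_mx (@conjc R) Y)^T).

Definition calY (D N M : nat) (a : 'I_N -> 'cV[R[i]]_D) (Y : 'M[R[i]]_(D, M))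
  (k : 'I_N) : R[i] :=
  \sum_(i < D) \sum_(j < D) conjc (a k i 0) * a k j 0 * Sigma_hat Y i j.

(* S^0 = { k : calY_k > mean of calY } (the calY_k are real; we compare real parts) *)
Definition S0 (D N M : nat) (a : 'I_N -> 'cV[R[i]]_D) (Y : 'M[R[i]]_(D, M)) :
  {set 'I_N} :=
  let Ybar := (N%:R)^-1 * \sum_(k < N) calY a Y k in
  [set k | complex.Re Ybar < complex.Re (calY a Y k)].

Definition supp (N : nat) (gam : 'I_N -> R) : {set 'I_N} := [set k | gam k != 0].

Definition gam_max (N : nat) (gam : 'I_N -> R) : R :=
  \big[Num.max/0]_(k in supp gam) gam k.

(* minimum of gam on its support (equal to gam_max-default if support empty) *)
Definition gam_min (N : nat) (gam : 'I_N -> R) : R :=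
  \big[Num.min/gam_max gam]_(k in supp gam) gam k.

End Statistics.

(* Main.v *)
Require Import Defs.
From HB Require Import structures.
From mathcomp Require Import all_boot all_order all_algebra.
From mathcomp Require Import all_classical all_reals all_analysis.
From mathcomp Require Import complex.
From mathcomp Require Import measurable_realfun normal_distribution ring lra.

(* Write s_k = a_k^* Sigma a_k, where Sigma = sum_l gamma_l a_l a_l^* + sigma^2 I is
   the covariance of the columns of Y given A.  Given A, M Y_k is the squared norm
   of a Gaussian vector of variance s_k per column, so Chernoff's bound gives
   Y_k > (1 - delta) s_k outside an event of probability exp (- M delta^2 / 16).
   By convexity of exp, the average of the Y_k obeys the same upper tail bound as a
   single Y_k, so log N does not enter the condition on M.  For k in the support,
   s_k >= gamma_min D^2 + sigma^2 D (the interference is nonnegative and is dropped),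
   while the average of the s_k is at most sigma^2 D plus a small multiple of
   gamma_min D^2 as soon as |a_k^* a_l|^2 <= 16 D log (D N) for all k <> l.  The
   latter holds with probability at least 1 - 4 / D^2: the law of <v, a_k> is the
   same for all unit vectors v, hence may be averaged over the v with entries
   +- 1 / sqrt n, which gives a subgaussian bound.

   The Gaussian moment generating functions are computed by integrating out one
   entry of H or Z at a time: completing the square shows that
   exp (theta (u + c g)^2) integrates to
   (1 - 2 theta c^2 v)^(-1/2) exp (theta u^2 / (1 - 2 theta c^2 v)),
   which has the same form in the remaining variables. *)

Set Implicit Arguments.
Unset Strict Implicit.
Unset Printing Implicit Defensive.

Import Order.TTheory GRing.Theory Num.Theory.
Local Open Scope classical_set_scope.
Local Open Scope ring_scope.

(** * Gaussian integrals *)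

Lemma complete_square {F : numFieldType} (v u c th x q : F) : v != 0 -> q != 0 ->
  q = 1 - 2 * th * c ^+ 2 * v ->
  th * (u + c * x) ^+ 2 - x ^+ 2 / (v *+ 2) =
  th * u ^+ 2 / q - (x - 2 * th * c * u * v / q) ^+ 2 / (v / q *+ 2).
Proof.
move=> v0 q0 qE; rewrite -(mulr_natr v) -(mulr_natr (v / q)).
(* [q] stays an atom while both sides are put over the denominator [2 * v * q]; its defining
   equation enters when the numerators are compared. *)
have -> : th * u ^+ 2 / q - (x - 2 * th * c * u * v / q) ^+ 2 / (v / q * 2) =
  (2 * v * th * u ^+ 2 - (q * x - 2 * th * c * u * v) ^+ 2) / (2 * v * q).
  by field; rewrite v0 q0.
have -> : th * (u + c * x) ^+ 2 - x ^+ 2 / (v * 2) =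
  (2 * v * q * th * (u + c * x) ^+ 2 - q * x ^+ 2) / (2 * v * q).
  by field; rewrite v0 q0.
congr (_ / _); rewrite qE; ring.
Qed.

Section gaussian_integral.
Context {R : realType}.
Local Notation mu := (@lebesgue_measure R).

(** The Radon-Nikodym derivative of the normal law agrees almost everywhere with [normal_pdf],
    having the same integral over every measurable set, so the change of variables may use the
    explicit density. *)
Lemma ge0_integral_normal_prob (m s : R) (f : R -> \bar R) :
  measurable_fun setT f -> (forall x, 0 <= f x)%E ->
  (\int[normal_prob m s]_x f x = \int[mu]_x (f x * (normal_pdf m s x)%:E))%E.
Proof.
move=> mf f0.
have dom := normal_prob_dominates m s.
rewrite -(Radon_Nikodym_SigmaFinite.change_of_variables dom f0 measurableT mf).
have mpdf : measurable_fun setT (fun x => (normal_pdf m s x)%:E).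
  by apply/measurable_EFinP; exact: measurable_normal_pdf.
have irn := Radon_Nikodym_SigmaFinite.f_integrable dom.
apply: ae_eq_integral => //.
- by apply: emeasurable_funM => //; apply: (measurable_int mu).
- by apply: emeasurable_funM.
- apply: ae_eqe_mul2l => /=.
  apply: integral_ae_eq => //= E ET mE.
  by rewrite -Radon_Nikodym_SigmaFinite.f_integral.
Qed.

(** After completion of the square the integrand is a constant times the density of the normal law
    with mean [m'] and variance [v / q], which has total mass one. The hypothesis on [th] says that
    [q] is positive. *)
Lemma integral_expR_sqr_normal (v u c th : R) : 0 < v -> 2 * th * c ^+ 2 * v < 1 ->
  (\int[normal_prob 0%R (Num.sqrt v)]_y (expR (th * (u + c * y) ^+ 2))%:E =
   ((Num.sqrt (1 - 2 * th * c ^+ 2 * v))^-1 *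
     expR (th * u ^+ 2 / (1 - 2 * th * c ^+ 2 * v)))%:E)%E.
Proof.
move=> v0; set q := 1 - _ => hq.
have q0 : 0 < q by rewrite subr_gt0.
have sv0 : 0 < Num.sqrt v by rewrite sqrtr_gt0.
have sq0 : 0 < Num.sqrt q by rewrite sqrtr_gt0.
set s' := Num.sqrt v / Num.sqrt q.
have s'0 : 0 < s' by rewrite divr_gt0.
have s'2 : s' ^+ 2 = v / q by rewrite /s' expr_div_n !sqr_sqrtr ?ltW.
set m' := 2 * th * c * u * v / q.
set k := _ * _.
rewrite ge0_integral_normal_prob; first last.
- by move=> x; rewrite lee_fin expR_ge0.
- apply/measurable_EFinP/measurableT_comp => //.
  apply: measurable_funM => //; apply: measurable_funX.
  by apply: measurable_funD => //; apply: measurable_funM.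
transitivity (\int[mu]_x (k%:E * (normal_pdf m' s' x)%:E))%E; last first.
  rewrite ge0_integralZl//.
  - by rewrite integral_normal_pdf mule1.
  - by apply/measurable_EFinP; exact: measurable_normal_pdf.
  - by move=> x _; rewrite lee_fin normal_pdf_ge0.
  - by rewrite lee_fin mulr_ge0 ?expR_ge0// invr_ge0 ltW.
apply: eq_integral => x _.
rewrite -!EFinM !normal_pdfE ?gt_eqF//; congr EFin.
rewrite /k /normal_peak /normal_fun s'2 sqr_sqrtr ?ltW//.
have -> : Num.sqrt ((v / q) * pi *+ 2) = Num.sqrt (v * pi *+ 2) / Num.sqrt q.
  rewrite -sqrtrV ?ltW// -sqrtrM.
    by congr Num.sqrt; rewrite !mulr2n mulrDl mulrAC.
  by rewrite mulrn_wge0// mulr_ge0 ?pi_ge0// ltW.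
have p0 : 0 < Num.sqrt (v * pi *+ 2).
  by rewrite sqrtr_gt0 mulrn_wgt0// mulr_gt0 ?pi_gt0.
rewrite invf_div.
transitivity ((Num.sqrt (v * pi *+ 2))^-1 *
   (expR (th * (u + c * x) ^+ 2) * expR (- (x - 0) ^+ 2 / (v *+ 2)))).
  by ring.
transitivity ((Num.sqrt (v * pi *+ 2))^-1 *
  (expR (th * u ^+ 2 / q) * expR (- (x - m') ^+ 2 / (v / q *+ 2)))); last first.
  by field; rewrite !gt_eqF.
congr (_ * _); rewrite -!expRD; congr expR.
rewrite subr0 !mulNr.
by apply: complete_square; rewrite // gt_eqF.
Qed.

End gaussian_integral.

(** * Independence of blocks *)

Section decoupling.
Context {R : realType} {d d1 d2 : measure_display} {T : measurableType d}
  {T1 : measurableType d1} {T2 : measurableType d2} (P : probability T R).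
Variables (X1 : T -> T1) (X2 : T -> T2).
Hypotheses (mX1 : measurable_fun setT X1) (mX2 : measurable_fun setT X2).

Lemma measurable_integral_indep (f : T1 * T2 -> \bar R) :
  measurable_fun setT f -> (forall x, 0 <= f x)%E ->
  measurable_fun setT (fun w2 => \int[P]_w1 f (X1 w1, X2 w2))%E.
Proof.
move=> mf f0.
pose mX1_ := isMeasurableFun.Build _ _ _ _ _ mX1.
pose Y1 : {mfun T >-> T1} := HB.pack X1 mX1_.
pose P1 : probability T1 R := distribution P Y1.
have -> : (fun w2 => \int[P]_w1 f (X1 w1, X2 w2))%E = fubini_G P1 f \o X2.
  apply/funext => w; rewrite /fubini_G /= ge0_integral_pushforward//=.
  exact: measurableT_comp.
apply: measurableT_comp => //; exact: measurable_fun_fubini_tonelli_G.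
Qed.

Hypothesis indep : forall A B, measurable A -> measurable B ->
  P (X1 @^-1` A `&` X2 @^-1` B) = (P (X1 @^-1` A) * P (X2 @^-1` B))%E.

(** Tonelli: by independence the law of the pair agrees with the product of the two laws on
    rectangles, hence everywhere. *)
Lemma ge0_integral_indep (f : T1 * T2 -> \bar R) :
  measurable_fun setT f -> (forall x, 0 <= f x)%E ->
  (\int[P]_w f (X1 w, X2 w) = \int[P]_w2 \int[P]_w1 f (X1 w1, X2 w2))%E.
Proof.
move=> mf f0.
pose mX1_ := isMeasurableFun.Build _ _ _ _ _ mX1.
pose Y1 : {mfun T >-> T1} := HB.pack X1 mX1_.
pose mX2_ := isMeasurableFun.Build _ _ _ _ _ mX2.
pose Y2 : {mfun T >-> T2} := HB.pack X2 mX2_.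
have mX12 : measurable_fun setT (fun w => (X1 w, X2 w)).
  exact/measurable_fun_pair.
pose mX12_ := isMeasurableFun.Build _ _ _ _ _ mX12.
pose Y12 : {mfun T >-> (T1 * T2)%type} := HB.pack (fun w => (X1 w, X2 w)) mX12_.
pose P1 : probability T1 R := distribution P Y1.
pose P2 : probability T2 R := distribution P Y2.
pose P12 : probability (T1 * T2)%type R := distribution P Y12.
transitivity (\int[P12]_z f z)%E.
  by rewrite /P12 /= ge0_integral_pushforward.
transitivity (\int[P1 \x P2]_z f z)%E.
  apply: eq_measure_integral => A mA _; apply/esym.
  have rect B C : measurable B -> measurable C -> P12 (B `*` C) = (P1 B * P2 C)%E.
    by move=> mB mC; exact: indep.
  exact: product_measure_unique rect _ mA.
rewrite fubini_tonelli2//= /fubini_G.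
rewrite ge0_integral_pushforward//=; last 2 first.
- exact: measurable_fun_fubini_tonelli_G.
- by move=> y _; apply: integral_ge0 => x _.
apply: eq_integral => w _ /=.
rewrite ge0_integral_pushforward//=.
exact: measurableT_comp.
Qed.

End decoupling.

Section blocks.
Context {R : realType} {d : measure_display} {T : measurableType d}
  (P : probability T R) {I : finType} (F : I -> set (set T)).
Hypothesis sF : forall i, sigma_algebra setT (F i).
Hypothesis Fm : forall i, F i `<=` measurable.
Hypothesis indF : mutually_independent P F.

(** A pi-system generating the joint sigma-algebra of the blocks in [J]; mutual independence
    evaluates [P] on its members as a product. *)
Definition cylinders (J : {set I}) : set (set T) :=
  [set A | exists E : I -> set T,
    (forall i, i \in J -> F i (E i)) /\ A = \bigcap_(i in [set` J]) E i].

(** The space [T] with the coarser sigma-algebra of the blocks in [J]. The identity into this type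
    acts as the random vector of all these blocks, and a function of the blocks is a measurable
    function on it. *)
Definition cylinderType (J : {set I}) := g_sigma_algebraType (cylinders J).

Definition block_measurable (J : {set I}) (f : T -> R) : Prop :=
  @measurable_fun _ _ (cylinderType J) R setT f.

Lemma block_setT i : F i setT.
Proof.
have [F0 FD _] := sF i.
by have := FD _ F0; rewrite setD0.
Qed.

Lemma block_setI i A B : F i A -> F i B -> F i (A `&` B).
Proof.
have [F0 FD FU] := sF i => FA FB.
have FC C : F i C -> F i (~` C) by move=> /FD; rewrite setTD.
rewrite -(setCK (A `&` B)) setCI -bigcup2E; apply: (FC _); apply: FU => -[|[|n]] //=; exact: FC.
Qed.

Lemma cylinders_measurable J : cylinders J `<=` measurable.
Proof.
move=> _ [E [FE ->]]; apply: fin_bigcap_measurable => //.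
by move=> i /= iJ; apply: Fm; exact: FE.
Qed.

Lemma sigma_cylinders_measurable J : <<s cylinders J >> `<=` measurable.
Proof.
apply: (smallest_sub (@sigma_algebra_measurable _ T)).
exact: cylinders_measurable.
Qed.

Lemma cylindersI J : setI_closed (cylinders J).
Proof.
move=> _ _ [E1 [FE1 ->]] [E2 [FE2 ->]]; exists (fun i => E1 i `&` E2 i).
split; first by move=> i iJ; apply: block_setI; [exact: FE1|exact: FE2].
by rewrite bigcapI.
Qed.

Lemma cylindersT J : cylinders J setT.
Proof.
exists (fun=> setT); split=> [i _|]; first exact: block_setT.
by rewrite bigcapT.
Qed.

Lemma cylindersS (J J' : {set I}) : J \subset J' -> cylinders J `<=` cylinders J'.
Proof.
move=> /fintype.subsetP JJ' _ [E [FE ->]]; exists (fun i => if i \in J then E i else setT).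
split; first by move=> i iJ'; case: ifPn => [/FE//|_]; exact: block_setT.
apply/seteqP; split=> [x h i /= iJ'|x h i /= iJ].
  by case: ifPn => // iJ; exact: h.
by have := h i (JJ' _ iJ); rewrite /= iJ.
Qed.

Lemma sub_cylinders (J : {set I}) i : i \in J -> F i `<=` cylinders J.
Proof.
move=> iJ A FA; exists (fun k => if k == i then A else setT); split.
  by move=> k _; case: eqP => [->//|_]; exact: block_setT.
apply/seteqP; split=> [x Ax k _|x h]; first by case: eqP.
by have := h i iJ; rewrite eqxx.
Qed.

Lemma block_measurableS (J J' : {set I}) f : J \subset J' ->
  block_measurable J f -> block_measurable J' f.
Proof.
move=> JJ' mf _ B mB; have := mf measurableT B mB; rewrite setTI.
apply: sub_smallest2r; first exact: smallest_sigma_algebra.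
exact: cylindersS.
Qed.

Lemma measurable_id_cylinder J :
  @measurable_fun _ _ T (cylinderType J) setT id.
Proof.
by move=> _ B mB; rewrite setTI preimage_id; exact: sigma_cylinders_measurable mB.
Qed.

Lemma block_measurable_measurable J f : block_measurable J f -> measurable_fun setT f.
Proof.
move=> mf; exact: (measurable_comp measurableT _ mf (@measurable_id_cylinder J)).
Qed.

(* The pi-lambda step: with [A] fixed, both [P (A `&` -)] and [P A * P -] are
   finite measures, and cylinders are stable under intersection. *)
Lemma indep_extend (G H : set (set T)) : setI_closed H -> H setT ->
  G `<=` measurable -> H `<=` measurable ->
  (forall A B, G A -> H B -> P (A `&` B) = (P A * P B)%E) ->
  forall A B, G A -> <<s H >> B -> P (A `&` B) = (P A * P B)%E.
Proof.
move=> HI HT Gm Hm GH A B GA.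
have mA := Gm _ GA.
have PA : P A \is a fin_num by rewrite fin_num_measure.
have PA0 : 0 <= fine (P A) by rewrite fine_ge0.
pose m1 : {measure set T -> \bar R} := mrestr P mA.
pose m2 : {measure set T -> \bar R} := mscale (NngNum PA0) P.
move=> sB.
have m1E C : m1 C = P (A `&` C) by rewrite setIC.
have m2E C : m2 C = (P A * P C)%E by rewrite -[X in (X * _)%E](fineK PA).
rewrite -m1E -m2E; apply: (@g_sigma_algebra_measure_unique _ _ _ H Hm (fun=> setT)) => //.
- by rewrite bigcup_const.
- by move=> C HC; rewrite m1E m2E GH.
- by move=> _; rewrite m1E setIT ltey_eq PA.
Qed.

(** On cylinders, two families of events over disjoint index sets glue to one over the union, and
    mutual independence factors the product. Then [indep_extend] is applied twice, to pass to the
    generated sigma-algebras one side at a time. *)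
Lemma indep_cylinders (J J' : {set I}) A B : [disjoint J & J']%B ->
  <<s cylinders J >> A -> <<s cylinders J' >> B -> P (A `&` B) = (P A * P B)%E.
Proof.
move=> JJ'.
have base A' B' : cylinders J A' -> cylinders J' B' -> P (A' `&` B') = (P A' * P B')%E.
  move=> [E1 [FE1 ->]] [E2 [FE2 ->]].
  pose E i := if i \in J then E1 i else E2 i.
  have -> : \bigcap_(i in [set` J]) E1 i `&` \bigcap_(i in [set` J']) E2 i =
            \bigcap_(i in [set` J :|: J']) E i.
    apply/seteqP; split=> [x [h1 h2] i /=|x h].
      by rewrite /E finset.in_setU; case: ifPn => [iJ _|_ /= iJ']; [exact: h1|exact: h2].
    split=> i /= iJ.
      by have := h i; rewrite /E /= finset.in_setU iJ /=; move/(_ isT).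
    have := h i; rewrite /E /= finset.in_setU iJ orbT /= => /(_ isT).
    by rewrite (disjointFl JJ' iJ).
  rewrite !indF//.
    rewrite (eq_bigl [predU J & J']); last by move=> i; rewrite finset.in_setU.
    rewrite bigU//=; congr (_ * _)%E; apply: eq_bigr => i iJ; rewrite /E ?iJ//.
    by rewrite (disjointFl JJ' iJ).
  move=> i; rewrite finset.in_setU /E; case: ifPn => [iJ _|_ /= iJ']; [exact: FE1|exact: FE2].
move=> sA sB.
apply: (@indep_extend <<s cylinders J >> (cylinders J')) => //.
- exact: cylindersI.
- exact: cylindersT.
- exact: sigma_cylinders_measurable.
- exact: cylinders_measurable.
(* Here [B] is still a cylinder; the two sides exchange roles. *)
- move=> {A B sA sB} A B sA cB; rewrite setIC muleC.
  apply: (@indep_extend (cylinders J') (cylinders J)) => //.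
  + exact: cylindersI.
  + exact: cylindersT.
  + exact: cylinders_measurable.
  + exact: cylinders_measurable.
  + by move=> B' A' cB' cA'; rewrite setIC muleC base.
Qed.

(** Tonelli for the identity maps onto the two coarser sigma-algebras: the repeated argument [w]
    splits into two independent copies. *)
Lemma ge0_integral_cylinders (J J' : {set I})
    (f : cylinderType J * cylinderType J' -> \bar R) : [disjoint J & J']%B ->
  measurable_fun setT f -> (forall x, 0 <= f x)%E ->
  (\int[P]_w f (w, w) = \int[P]_w2 \int[P]_w1 f (w1, w2))%E.
Proof.
move=> JJ' mf f0.
apply: (@ge0_integral_indep _ _ _ _ T (cylinderType J) (cylinderType J') P id id) => //.
- exact: measurable_id_cylinder.
- exact: measurable_id_cylinder.
- by move=> A B mA mB; rewrite !preimage_id; exact: (indep_cylinders JJ').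
Qed.

Lemma measurable_integral_cylinders (J J' : {set I})
    (f : cylinderType J * cylinderType J' -> \bar R) :
  measurable_fun setT f -> (forall x, 0 <= f x)%E ->
  measurable_fun setT (fun w2 : T => \int[P]_w1 f (w1, w2))%E.
Proof.
apply: (@measurable_integral_indep _ _ _ _ T (cylinderType J) (cylinderType J') P id id).
- exact: measurable_id_cylinder.
- exact: measurable_id_cylinder.
Qed.

End blocks.

(** * Measurability of inverses, square roots, comparisons and finite sums *)

Lemma measurable_invr {R : realType} : measurable_fun [set: R] (@GRing.inv R).
Proof.
(* The power is taken of the nonnegative [x ^+ 2]; at zero both sides vanish, as the inverse of zero
   is zero. *)
rewrite (_ : GRing.inv = fun x : R => x * (x ^+ 2) `^ (-1)).
  apply: measurable_funM => //.
  by apply: (measurableT_comp (measurable_powR _)); exact: measurable_funX.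
apply/funext => x; rewrite powR_inv1 ?sqr_ge0//.
have [->|x0] := eqVneq x 0; first by rewrite invr0 mul0r.
by rewrite expr2 invfM mulrA divff// mul1r.
Qed.

Lemma measurable_sqrtr {R : realType} : measurable_fun [set: R] (@Num.sqrt R).
Proof.
rewrite (_ : Num.sqrt = fun x : R => (Num.max x 0) `^ (2^-1)).
  apply: (measurableT_comp (measurable_powR _)).
  exact: measurable_maxr.
apply/funext => x; rewrite powR12_sqrt ?le_max ?lexx ?orbT//.
by have [x0|x0] := lerP x 0; rewrite // sqrtr0 ler0_sqrtr.
Qed.

Lemma measurable_set_ltr {R : realType} {d} {T : measurableType d} (f h : T -> R) :
  measurable_fun setT f -> measurable_fun setT h -> measurable [set w | f w < h w].
Proof.
move=> mf mh.
have -> : [set w | f w < h w] = ~` (setT `&` [set w | h w <= f w]).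
  by apply/funext => w; rewrite setTI /mkset /= /setC /mkset /= ltNge; apply/propext; split=> /negP.
by apply: measurableC; exact: measurable_fun_le.
Qed.

Lemma measurable_sum_seq {R : realType} {d} {T : measurableType d} (D : set T)
    (I : eqType) (s : seq I) (h : I -> T -> R) :
  (forall i, i \in s -> measurable_fun D (h i)) ->
  measurable_fun D (fun x => \sum_(i <- s) h i x).
Proof.
elim: s => [mh|x s ih mh].
  by under eq_fun do rewrite big_nil//=; exact: measurable_cst.
under eq_fun do rewrite big_cons//=; apply: measurable_funD => //.
- by apply: mh; rewrite mem_head.
- by apply: ih => n ny; apply: mh; rewrite inE orbC ny.
Qed.

(** * Integrating out Gaussian variables *)

Section gaussian_law.
Context {R : realType} {d : measure_display} {T : measurableType d}
  (P : probability T R).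

Lemma integral_expR_sqr_gaussian (g : T -> R) (v u c th : R) :
  measurable_fun setT g -> real_normal P g 0 v -> 0 <= v ->
  2 * th * c ^+ 2 * v < 1 ->
  (\int[P]_w (expR (th * (u + c * g w) ^+ 2))%:E =
   ((Num.sqrt (1 - 2 * th * c ^+ 2 * v))^-1 *
     expR (th * u ^+ 2 / (1 - 2 * th * c ^+ 2 * v)))%:E)%E.
Proof.
move=> mg gv v0 hq.
have mf : measurable_fun setT (fun y : R => (expR (th * (u + c * y) ^+ 2))%:E).
  apply/measurable_EFinP/measurableT_comp => //.
  apply: measurable_funM => //; apply: measurable_funX.
  by apply: measurable_funD => //; apply: measurable_funM.
(* Zero variance, as for the noise when [sigma] is zero: the law is the Dirac mass at zero, and the
   formula reduces to its value at [g = 0]. *)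
have [v00|vn0] := eqVneq v 0.
  pose mg_ := isMeasurableFun.Build _ _ _ _ _ mg.
  pose Y : {mfun T >-> R} := HB.pack g mg_.
  transitivity (\int[distribution P Y]_y (expR (th * (u + c * y) ^+ 2))%:E)%E.
    by rewrite ge0_integral_pushforward//= => y _; rewrite lee_fin expR_ge0.
  transitivity (\int[\d_(0%R:R)]_y (expR (th * (u + c * y) ^+ 2))%:E)%E.
    apply: eq_measure_integral => A mA _ /=.
    by have := gv _ mA; rewrite v00 eqxx.
  rewrite integral_dirac// diracT mul1e mulr0 addr0 v00 mulr0 subr0.
  by rewrite sqrtr1 invr1 mul1r mulr1.
rewrite -integral_expR_sqr_normal// ?lt_def ?vn0//.
pose mg' : @measurable_fun _ _ T (measurableTypeR R) setT g := mg.
pose mg'_ := isMeasurableFun.Build _ _ _ _ _ mg'.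
pose Y' : {mfun T >-> measurableTypeR R} := HB.pack g mg'_.
transitivity (\int[distribution P Y']_y (expR (th * (u + c * y) ^+ 2))%:E)%E.
  by rewrite ge0_integral_pushforward//= => y _; rewrite lee_fin expR_ge0.
apply: eq_measure_integral => A mA _ /=.
by have := gv _ mA; rewrite (negbTE vn0).
Qed.

End gaussian_law.

Section gaussian_steps.
Context {R : realType} {d : measure_display} {T : measurableType d}
  (P : probability T R) {I : finType} (F : I -> set (set T)).
Hypothesis sF : forall i, sigma_algebra setT (F i).
Hypothesis Fm : forall i, F i `<=` measurable.
Hypothesis indF : mutually_independent P F.
Local Notation bmeas := (block_measurable F).

Lemma block_measurable_of (J : {set I}) i (g : T -> R) : i \in J ->
  (forall B, measurable B -> F i (g @^-1` B)) -> bmeas J g.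
Proof.
move=> iJ Fg _ B mB; rewrite setTI; apply: sub_sigma_algebra.
by apply: (sub_cylinders sF iJ); exact: Fg.
Qed.

(** [g] is independent of the blocks in [J], which carry everything else, so Tonelli freezes the
    latter while [g] is integrated. *)
Lemma gaussian_step (J : {set I}) i (g W th U c : T -> R) (v : R) :
  i \notin J -> (forall B, measurable B -> F i (g @^-1` B)) ->
  real_normal P g 0 v -> 0 <= v ->
  bmeas J W -> bmeas J th -> bmeas J U -> bmeas J c ->
  (forall w, 0 <= W w) -> (forall w, 2 * th w * c w ^+ 2 * v < 1) ->
  (\int[P]_w (W w * expR (th w * (U w + c w * g w) ^+ 2))%:E =
   \int[P]_w (W w * ((Num.sqrt (1 - 2 * th w * c w ^+ 2 * v))^-1 *
     expR (th w * U w ^+ 2 / (1 - 2 * th w * c w ^+ 2 * v))))%:E)%E.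
Proof.
move=> iJ Fg gv v0 mW mth mU mc W0 hq.
have mg : measurable_fun setT g.
  by move=> _ B mB; rewrite setTI; apply: Fm; exact: Fg.
pose f (z : R * cylinderType F J) : \bar R :=
  (W z.2 * expR (th z.2 * (U z.2 + c z.2 * z.1) ^+ 2))%:E.
have m2 (h : T -> R) : bmeas J h ->
    measurable_fun setT (fun z : R * cylinderType F J => h z.2).
  by move=> mh; apply: (measurableT_comp mh); exact: measurable_snd.
have m1 : measurable_fun setT (fun z : R * cylinderType F J => z.1).
  exact: measurable_fst.
have mf : measurable_fun setT f.
  apply/measurable_EFinP; apply: measurable_funM; first exact: m2.
  apply: measurableT_comp => //; apply: measurable_funM; first exact: m2.
  apply: measurable_funX; apply: measurable_funD; first exact: m2.
  by apply: measurable_funM => //; exact: m2.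
have f0 z : (0 <= f z)%E by rewrite lee_fin mulr_ge0// expR_ge0.
have dis : [disjoint [set i]%SET & J]%B by rewrite disjoints1.
transitivity (\int[P]_w2 \int[P]_w1 f (g w1, w2))%E.
  apply: (@ge0_integral_indep _ _ _ _ T R (cylinderType F J) P g id) => //.
  - exact: measurable_id_cylinder.
  - move=> A B mA mB; apply: (indep_cylinders sF Fm indF dis) => //.
    apply: sub_sigma_algebra; apply: (sub_cylinders sF (finset.set11 i)); exact: Fg.
apply: eq_integral => w _; rewrite /f /=.
under eq_integral do rewrite EFinM.
rewrite ge0_integralZl//; last by rewrite lee_fin.
- by rewrite (@integral_expR_sqr_gaussian _ _ _ P g v).
- apply/measurable_EFinP/measurableT_comp => //.
  apply: measurable_funM => //; apply: measurable_funX.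
  by apply: measurable_funD => //; apply: measurable_funM.
Qed.

Lemma bmeas_comp (J : {set I}) (h : R -> R) (f : T -> R) :
  measurable_fun setT h -> bmeas J f -> bmeas J (fun w => h (f w)).
Proof. by move=> mh mf; exact: measurableT_comp mh mf. Qed.

(** Induction on the list: integrating out the head divides [W] by the square root of [q] and [th]
    by [q], and leaves an integral of the same shape over the tail. This is why [W] and [th] are
    functions of [w] rather than constants. *)
Lemma gaussian_comb (L : eqType) (blk : L -> I) (g : L -> T -> R) (v : L -> R)
    (c : L -> T -> R) (ls : seq L) (J : {set I}) (W th : T -> R) :
  uniq (map blk ls) -> (forall l, l \in ls -> blk l \notin J) ->
  (forall l B, measurable B -> F (blk l) (g l @^-1` B)) ->
  (forall l, real_normal P (g l) 0 (v l)) -> (forall l, 0 <= v l) ->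
  bmeas J W -> bmeas J th -> (forall l, bmeas J (c l)) ->
  (forall w, 0 <= W w) ->
  (forall w, 2 * th w * (\sum_(l <- ls) c l w ^+ 2 * v l) < 1) ->
  (\int[P]_w (W w * expR (th w * (\sum_(l <- ls) c l w * g l w) ^+ 2))%:E =
   \int[P]_w (W w *
      (Num.sqrt (1 - 2 * th w * (\sum_(l <- ls) c l w ^+ 2 * v l)))^-1)%:E)%E.
Proof.
move=> + + Fg gv v0 + + mc.
elim: ls W th => [|l ls IH] W th.
  move=> _ _ mW mth W0 _; apply: eq_integral => w _.
  by rewrite !big_nil expr0n !mulr0 expR0 subr0 sqrtr1 invr1.
rewrite map_cons cons_uniq => /andP[lls uls] nJ mW mth W0 hq.
(* [J'] adds the blocks of the tail: the tail sum [U] is measurable for it, and the head stays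
   independent of it. *)
pose J' : {set I} := J :|: [set i in map blk ls]%SET.
have lJ' : blk l \notin J'.
  by rewrite finset.in_setU finset.inE negb_or lls andbT; apply: nJ; rewrite mem_head.
have up (f : T -> R) : bmeas J f -> bmeas J' f.
  by apply: block_measurableS => //; exact: finset.subsetUl.
pose q w := 1 - 2 * th w * c l w ^+ 2 * v l.
pose S w := \sum_(l <- ls) c l w ^+ 2 * v l.
have S0 w : 0 <= S w by apply: sumr_ge0 => k _; rewrite mulr_ge0 ?sqr_ge0.
have hq' w : 0 < 1 - 2 * th w * (c l w ^+ 2 * v l + S w).
  by have := hq w; rewrite big_cons subr_gt0.
have cv0 w : 0 <= c l w ^+ 2 * v l by rewrite mulr_ge0 ?sqr_ge0.
(* [th] may have either sign: if it is nonpositive then [q] is at least one, and otherwise [q] is at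
   least the positive quantity of [hq']. *)
have q0 w : 0 < q w.
  rewrite /q; have [t0|t0] := leP (th w) 0.
    have := cv0 w; nra.
  have := S0 w; have := hq' w; nra.
pose U w := \sum_(k <- ls) c k w * g k w.
have mU : bmeas J' U.
  apply: measurable_sum_seq => k kls; apply: measurable_funM; first exact: up.
  apply: (block_measurable_of _ (@Fg k)).
  by rewrite finset.in_setU finset.inE map_f ?orbT.
have mq : bmeas J q.
  apply: measurable_funB => //; apply: measurable_funM => //.
  apply: measurable_funM; last by apply: measurable_funX; exact: mc.
  by apply: measurable_funM => //; exact: mth.
have mW' : bmeas J (fun w => W w * (Num.sqrt (q w))^-1).
  apply: measurable_funM => //; apply: (bmeas_comp measurable_invr).
  exact: (bmeas_comp measurable_sqrtr).
have mth' : bmeas J (fun w => th w / q w).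
  by apply: measurable_funM => //; exact: (bmeas_comp measurable_invr).
transitivity (\int[P]_w (W w * expR (th w * (U w + c l w * g l w) ^+ 2))%:E)%E.
  by apply: eq_integral => w _; rewrite big_cons addrC.
have hstep w : 2 * th w * c l w ^+ 2 * v l < 1 by rewrite -subr_gt0; exact: q0.
rewrite (gaussian_step lJ' (@Fg l) (gv l) (v0 l) (up _ mW) (up _ mth) mU
  (up _ (mc l)) W0 hstep).
transitivity (\int[P]_w (W w * (Num.sqrt (q w))^-1 *
    expR (th w / q w * (\sum_(l <- ls) c l w * g l w) ^+ 2))%:E)%E.
  by apply: eq_integral => w _; rewrite (mulrAC (th w) (q w)^-1) mulrA.
rewrite IH//.
- apply: eq_integral => w _; congr EFin.
  (* The factors telescope: [q * (1 - 2 * (th / q) * S) = 1 - 2 * th * (c ^+ 2 * v + S)]. *)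
  rewrite -mulrA -invfM -sqrtrM ?ltW// big_cons -/(S w); congr (_ * (Num.sqrt _)^-1).
  have := gt_eqF (q0 w); rewrite /q => h; field; exact: negbT.
- by move=> k kls; apply: nJ; rewrite inE kls orbT.
- by move=> w; rewrite mulr_ge0// invr_ge0.
- move=> w; rewrite mulrA mulrAC ltr_pdivrMr// mul1r -/(S w).
  by have := hq' w; rewrite /q; nra.
Qed.

(** A chi-square moment generating function: the copies indexed by [ks] share their coefficients,
    hence each contributes the same factor. One copy is integrated at a time, with the others put
    into the weight [W]. *)
Lemma gaussian_chi2 (K L : eqType) (blk : K -> L -> I) (g : K -> L -> T -> R)
    (v : L -> R) (c : L -> T -> R) (ks : seq K) (ls : seq L) (J : {set I})
    (W th : T -> R) :
  uniq ks -> uniq ls ->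
  (forall k k' l l', blk k l = blk k' l' -> k = k' /\ l = l') ->
  (forall k l, blk k l \notin J) ->
  (forall k l B, measurable B -> F (blk k l) (g k l @^-1` B)) ->
  (forall k l, real_normal P (g k l) 0 (v l)) -> (forall l, 0 <= v l) ->
  bmeas J W -> bmeas J th -> (forall l, bmeas J (c l)) ->
  (forall w, 0 <= W w) ->
  (forall w, 2 * th w * (\sum_(l <- ls) c l w ^+ 2 * v l) < 1) ->
  (\int[P]_w (W w *
      expR (th w * \sum_(k <- ks) (\sum_(l <- ls) c l w * g k l w) ^+ 2))%:E =
   \int[P]_w (W w *
      (Num.sqrt (1 - 2 * th w * (\sum_(l <- ls) c l w ^+ 2 * v l)))^-1
        ^+ size ks)%:E)%E.
Proof.
move=> + uls inj nJ Fg gv v0 + mth mc + hq.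
elim: ks W => [|k ks IH] W.
  by move=> _ mW W0; apply: eq_integral => w _; rewrite big_nil mulr0 expR0.
rewrite cons_uniq => /andP[kks uks] mW W0.
pose J' : {set I} := J :|: [set i in [seq blk k' l | k' <- ks, l <- ls]]%SET.
have up (f : T -> R) : bmeas J f -> bmeas J' f.
  by apply: block_measurableS => //; exact: finset.subsetUl.
pose Q w := \sum_(k <- ks) (\sum_(l <- ls) c l w * g k l w) ^+ 2.
pose z w := (Num.sqrt (1 - 2 * th w * (\sum_(l <- ls) c l w ^+ 2 * v l)))^-1.
have mz : bmeas J z.
  apply: (bmeas_comp measurable_invr); apply: (bmeas_comp measurable_sqrtr).
  apply: measurable_funB => //; apply: measurable_funM.
    by apply: measurable_funM => //; exact: mth.
  apply: measurable_sum => l; apply: measurable_funM => //.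
  by apply: measurable_funX; exact: mc.
have mQ : bmeas J' Q.
  apply: measurable_sum_seq => k' k'ks; apply: measurable_funX.
  apply: measurable_sum_seq => l lls; apply: measurable_funM; first exact: up.
  apply: (block_measurable_of _ (@Fg k' l)).
  by rewrite finset.in_setU finset.inE allpairs_f ?orbT.
transitivity (\int[P]_w (W w * expR (th w * Q w) *
    expR (th w * (\sum_(l <- ls) c l w * g k l w) ^+ 2))%:E)%E.
  by apply: eq_integral => w _; rewrite big_cons -mulrA -expRD -mulrDr addrC.
have mW' : bmeas J' (fun w => W w * expR (th w * Q w)).
  apply: measurable_funM; first exact: up.
  apply: measurableT_comp => //; apply: measurable_funM => //; exact: up.
rewrite (gaussian_comb _ _ (Fg k) (gv k) v0 mW' (up _ mth) (fun l => up _ (mc l)) _ hq).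
- transitivity (\int[P]_w (W w * z w * expR (th w * Q w))%:E)%E.
    by apply: eq_integral => w _; rewrite mulrAC.
  rewrite IH//.
  + by apply: eq_integral => w _; rewrite -mulrA -exprS.
  + exact: measurable_funM.
  + by move=> w; rewrite mulr_ge0// invr_ge0.
- by rewrite map_inj_uniq// => l l' /inj[].
- move=> l lls; rewrite finset.in_setU negb_or nJ finset.inE.
  by apply/negP => /allpairsP[[k' l'] /= [k'ks _ /inj[kk' _]]]; rewrite kk' k'ks in kks.
- by move=> w; rewrite mulr_ge0// expR_ge0.
Qed.

End gaussian_steps.

(** * Chernoff bounds for Gaussian quadratic forms *)

(** Convexity, in the form of the tangent to [expR] at the mean [m]. *)
Lemma expR_jensen {R : realType} (J : finType) (p x : J -> R) :
  (forall r, 0 <= p r) -> \sum_r p r = 1 ->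
  expR (\sum_r p r * x r) <= \sum_r p r * expR (x r).
Proof.
move=> p0 p1; set m := \sum_r _.
have tangent r : expR m * (1 + (x r - m)) <= expR (x r).
  have -> : x r = m + (x r - m) by rewrite addrC subrK.
  by rewrite expRD ler_wpM2l ?expR_ge0// addrAC subrr add0r expR_ge1Dx.
apply: (@le_trans _ _ (\sum_r p r * (expR m * (1 + (x r - m))))); last first.
  by apply: ler_sum => r _; rewrite ler_wpM2l.
have -> // : \sum_r p r * (expR m * (1 + (x r - m))) = expR m.
rewrite (eq_bigr (fun r => expR m * ((1 - m) * p r + p r * x r))); last first.
  by move=> r _; ring.
by rewrite -mulr_sumr big_split/= -mulr_sumr p1 mulr1 -/m subrK mulr1.
Qed.

(** One inequality serves both tails: for positive [t] the hypothesis says [y <= 1], for negative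
    [t] it says [1 <= y], and in both cases [y] may be replaced by one. *)
Lemma sqrtr_inv_le_expR {R : realType} (t y : R) : t <= 4^-1 -> t * y <= t ->
  (Num.sqrt (1 - 2 * t * y))^-1 <= expR (t + 4 * t ^+ 2).
Proof.
move=> t4 ty.
have h : 0 < 1 - 2 * t * y by lra.
have h' : 0 < 1 - 2 * t by lra.
have e0 := expR_ge0 (t + 4 * t ^+ 2).
rewrite -sqrtrV; last exact: ltW.
rewrite -(ger0_norm e0) -sqrtr_sqr.
apply: ler_wsqrtr.
apply: (@le_trans _ _ (1 - 2 * t)^-1); first by rewrite lef_pV2 ?posrE//; lra.
rewrite expr2 -expRD -[leLHS]mul1r ler_pdivrMr//.
(* What remains is [(1 - 2 t) (1 + 2 t + 8 t^2) = 1 + 4 t^2 (1 - 4 t) >= 1], where [t <= 1/4]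
   enters. *)
have := expR_ge1Dx (t + 4 * t ^+ 2 + (t + 4 * t ^+ 2)).
by nra.
Qed.

Section chernoff.
Context {R : realType} {d : measure_display} {T : measurableType d}
  (P : probability T R) {I : finType} (F : I -> set (set T)).
Hypothesis sF : forall i, sigma_algebra setT (F i).
Hypothesis Fm : forall i, F i `<=` measurable.
Hypothesis indF : mutually_independent P F.
Local Notation bmeas := (block_measurable F).
Variables (K L Rw : finType) (blk : K -> L -> I) (g : K -> L -> T -> R)
  (v : L -> R) (J : {set I}).
Hypothesis inj : forall k k' l l', blk k l = blk k' l' -> k = k' /\ l = l'.
Hypothesis nJ : forall k l, blk k l \notin J.
Hypothesis Fg : forall k l B, measurable B -> F (blk k l) (g k l @^-1` B).
Hypothesis gv : forall k l, real_normal P (g k l) 0 (v l).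
Hypothesis v0 : forall l, 0 <= v l.

(* [s' r] is any positive proxy for the conditional variance of row [r] that
   lies on the right side of it on the event [A]. *)
Lemma chernoff_rows (c : Rw -> L -> T -> R) (s' : Rw -> T -> R) (A : set T) (t u : R) :
  let Q r w := \sum_k (\sum_l c r l w * g k l w) ^+ 2 in
  (forall r l, bmeas J (c r l)) -> (forall r, bmeas J (s' r)) ->
  @measurable _ (cylinderType F J) A -> (0 < #|Rw|)%N ->
  (forall r w, 0 < s' r w) -> t <= 4^-1 ->
  (forall r w, A w -> t * (\sum_l c r l w ^+ 2 * v l) <= t * s' r w) ->
  (P (A `&` [set w | (t * (u * #|K|%:R * \sum_r s' r w) <= t * \sum_r Q r w)%R]) <=
    (expR (#|K|%:R * (t + 4 * t ^+ 2 - t * u)))%:E)%E.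
Proof.
move=> Q mc ms' mA /card_gt0P[r0 _] s'0 t4 hA.
pose a : T -> R := \1_A.
have ma : bmeas J a by exact: measurable_indic.
have meas f : bmeas J f -> measurable_fun setT f.
  exact: (block_measurable_measurable Fm).
have a01 w : a w = 0 \/ a w = 1 by rewrite /a indicE; case: (_ \in _); [right|left].
have a0 w : 0 <= a w by case: (a01 w) => ->.
pose S w := \sum_r s' r w.
have S0 w : 0 < S w.
  rewrite /S (bigD1 r0)//= ltr_pwDl//; apply: sumr_ge0 => r _; exact: ltW.
have mS : bmeas J S by apply: measurable_sum => r; exact: ms'.
(* Weights proportional to [s'] turn each [p r * (t / s' r) * Q r] into [t * Q r / S], so Jensen's
   inequality bounds the exponential of the total by a mean of single-row exponentials. *)
pose p r w := s' r w / S w.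
have p0 r w : 0 <= p r w by rewrite divr_ge0 ?ltW.
have mp r : bmeas J (p r).
  by apply: measurable_funM; [exact: ms'|exact: (bmeas_comp measurable_invr)].
have p1 w : \sum_r p r w = 1 by rewrite /p -mulr_suml -/(S w) divff// gt_eqF.
have mQ r : measurable_fun setT (Q r).
  apply: measurable_sum => k; apply: measurable_funX; apply: measurable_sum => l.
  apply: measurable_funM; first exact/meas.
  by move=> _ B mB; rewrite setTI; apply: Fm; exact: Fg.
(* The indicator [a] sets the exponent to zero outside [A], so that the condition of [gaussian_chi2]
   holds at every [w]. *)
pose th r w := a w * (t / s' r w).
have mth r : bmeas J (th r).
  apply: measurable_funM => //; apply: measurable_funM => //.
  by apply: (bmeas_comp measurable_invr).
pose W r w := a w * p r w.
have mW r : bmeas J (W r) by apply: measurable_funM => //; exact: mp.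
have W0 r w : 0 <= W r w by rewrite mulr_ge0.
pose q r w := \sum_l c r l w ^+ 2 * v l.
have hy r w : a w * t * (q r w / s' r w) <= a w * t /\ a w * t <= 4^-1.
  rewrite /a indicE; have [/set_mem Aw|_] := boolP (w \in A); rewrite ?(mul0r, mul1r).
    by split=> //; rewrite mulrA ler_pdivrMr//; exact: hA.
  by split=> //; rewrite invr_ge0.
have hq r w : 2 * th r w * q r w < 1.
  have [h1 h2] := hy r w.
  have -> : 2 * th r w * q r w = 2 * (a w * t * (q r w / s' r w)) by rewrite /th; ring.
  lra.
pose E0 := expR (t + 4 * t ^+ 2).
have E00 : 0 <= E0 by exact: expR_ge0.
set E := _ `&` _.
have mE : measurable E.
  apply: measurableI.
    exact: (sigma_cylinders_measurable Fm mA).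
  rewrite -[X in measurable X]setTI; apply: measurable_fun_le => //.
    by apply: measurable_funM => //; apply: measurable_funM => //; exact: meas.
  by apply: measurable_funM => //; exact: measurable_sum.
pose z : R := expR (- (t * u * #|K|%:R)).
have z0 : 0 <= z by exact: expR_ge0.
have mWQ r : measurable_fun setT (fun w => W r w * expR (th r w * Q r w)).
  apply: measurable_funM; first exact: meas.
  apply: measurableT_comp => //; apply: measurable_funM => //; exact: meas.
(* Markov's inequality in pointwise form, [z] being the inverse of the exponential at the
   threshold. *)
have lb w : \1_E w <= z * \sum_r W r w * expR (th r w * Q r w).
  rewrite indicE; have [/set_mem[Aw hw]|_] := boolP (w \in E); last first.
    by rewrite mulr_ge0// sumr_ge0// => r _; rewrite mulr_ge0// expR_ge0.
  have a1 : a w = 1 by rewrite /a indicE mem_set.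
  apply: (@le_trans _ _ (z * expR (\sum_r p r w * (th r w * Q r w)))); last first.
    rewrite ler_wpM2l//; under [leRHS]eq_bigr do rewrite /W a1 mul1r.
    exact: expR_jensen.
  rewrite /z -expRD -[leLHS]expR0 ler_expR addrC subr_ge0.
  have -> : \sum_r p r w * (th r w * Q r w) = (t * \sum_r Q r w) / S w.
    rewrite mulr_sumr mulr_suml; apply: eq_bigr => r _.
    by rewrite /p /th a1; field; rewrite !gt_eqF.
  by rewrite ler_pdivlMr//; move: hw; rewrite /= !mulrA.
(* The exact Gaussian integral of a row is compared with [E0], the ratio of the variance to [s']
   being on the favourable side of one on [A]. *)
have step r : (\int[P]_w (W r w * expR (th r w * Q r w))%:E <=
               \int[P]_w (W r w * E0 ^+ #|K|)%:E)%E.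
  have sK : size (index_enum K) = #|K| by rewrite cardE enumT.
  have -> := @gaussian_chi2 _ _ _ P I F sF Fm indF K L blk g v (c r)
    (index_enum K) (index_enum L) J (W r) (th r) (index_enum_uniq _)
    (index_enum_uniq _) inj nJ Fg gv v0 (mW r) (mth r) (mc r) (W0 r) (hq r).
  have mz : bmeas J (fun w => (Num.sqrt (1 - 2 * th r w * q r w))^-1).
    apply: (bmeas_comp measurable_invr); apply: (bmeas_comp measurable_sqrtr).
    apply: measurable_funB => //; apply: measurable_funM.
      by apply: measurable_funM => //; exact: mth.
    apply: measurable_sum => l; apply: measurable_funM => //.
    by apply: measurable_funX; exact: mc.
  rewrite sK; apply: ge0_le_integral => //.
  - by move=> w _; rewrite lee_fin mulr_ge0// exprn_ge0// invr_ge0.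
  - apply/measurable_EFinP; apply: measurable_funM; first exact: meas.
    by apply: measurable_funX; exact: meas.
  - by apply/measurable_EFinP; apply: measurable_funM => //; exact: meas.
  - move=> w _; rewrite lee_fin; have [aw0|aw1] := a01 w.
      by rewrite /W aw0 !mul0r.
    rewrite ler_wpM2l//; apply: lerXn2r; rewrite ?nnegrE ?invr_ge0//.
    have := hy r w; rewrite /th aw1 !mul1r => -[h1 h2].
    have -> : 2 * (t / s' r w) * q r w = 2 * t * (q r w / s' r w) by ring.
    exact: sqrtr_inv_le_expR.
have -> : expR (#|K|%:R * (t + 4 * t ^+ 2 - t * u)) = z * E0 ^+ #|K|.
  by rewrite /z /E0 -expRM_natl -expRD; congr expR; ring.
apply: (@le_trans _ _ (\int[P]_w (z * \sum_r W r w * expR (th r w * Q r w))%:E)%E).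
  have <- : (\int[P]_w (\1_E w)%:E = P E)%E by rewrite integral_indic// setIT.
  apply: ge0_le_integral => //.
  - by apply/measurable_EFinP; exact: measurable_indic.
  - apply/measurable_EFinP; apply: measurable_funM => //.
    by apply: measurable_sum => r.
  - by move=> w _; rewrite lee_fin lb.
under eq_integral do rewrite EFinM.
rewrite ge0_integralZl//; first last.
- by move=> w _; rewrite lee_fin sumr_ge0// => r _; rewrite mulr_ge0// expR_ge0.
- by apply/measurable_EFinP; apply: measurable_sum => r.
rewrite EFinM lee_wpmul2l//.
under eq_integral do rewrite -sumEFin.
rewrite ge0_integral_sum//; first last.
- by move=> r w _; rewrite lee_fin mulr_ge0// expR_ge0.
- by move=> r; apply/measurable_EFinP.
apply: (@le_trans _ _ (\sum_r \int[P]_w (W r w * E0 ^+ #|K|)%:E)%E).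
  by apply: lee_sum => r _.
rewrite -ge0_integral_sum//; first last.
- by move=> r w _; rewrite lee_fin mulr_ge0// exprn_ge0.
- by move=> r; apply/measurable_EFinP; apply: measurable_funM => //; exact: meas.
apply: (@le_trans _ _ (\int[P]_w (E0 ^+ #|K|)%:E)%E); last first.
  by rewrite integral_cst//= probability_setT mule1.
apply: ge0_le_integral => //.
- by move=> w _; apply: sume_ge0 => r _; rewrite lee_fin mulr_ge0// exprn_ge0.
- under eq_fun do rewrite sumEFin; apply/measurable_EFinP.
  by apply: measurable_sum => r; apply: measurable_funM => //; exact: meas.
(* The weights sum to the indicator of [A], which is at most one, so no factor [#|Rw|] is lost. *)
- move=> w _; rewrite sumEFin lee_fin -mulr_suml ler_piMl ?exprn_ge0//.
  rewrite /W -mulr_sumr p1 mulr1.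
  by case: (a01 w) => ->.
Qed.

End chernoff.

(** * Uniform vectors on the sphere *)

(* Scaling up from small arguments through [cosh (2 y) <= cosh y ^ 4]. *)
Lemma coshr_le_expR {R : realType} (x : R) :
  (expR x + expR (- x)) / 2 <= expR (2 * x ^+ 2).
Proof.
(* With [z = y / 2], [cosh y = 1 + (exp z - exp (- z))^2 / 2], and the difference of exponentials is
   at most [4 z] on this range. *)
have small (y : R) : 0 <= y -> y <= 1 -> (expR y + expR (- y)) / 2 <= expR (2 * y ^+ 2).
  move=> y0 y1; pose z := y / 2.
  have e1 : expR z * expR (- z) = 1 by rewrite -expRD subrr expR0.
  have hy : expR y = expR z * expR z by rewrite -expRD; congr expR; rewrite /z; lra.
  have hmy : expR (- y) = expR (- z) * expR (- z).
    by rewrite -expRD; congr expR; rewrite /z; lra.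
  have a1 := expR_ge1Dx z; have a2 := expR_ge1Dx (- z).
  have a3 := expR_ge1Dx (2 * y ^+ 2).
  have p1 := expR_gt0 z; have p2 := expR_gt0 (- z).
  have z1 : y = 2 * z by rewrite /z; lra.
  have z0 : 0 <= z by lra.
  have z2 : z <= 1 / 2 by lra.
  rewrite hy hmy; apply: le_trans a3.
  have b0 : 0 <= expR z - expR (- z) by nra.
  have b1 : expR z - expR (- z) <= 4 * z by nra.
  have b2 : (expR z - expR (- z)) ^+ 2 <= (4 * z) ^+ 2.
    by rewrite ler_pXn2r ?nnegrE//; lra.
  rewrite z1; nra.
have scaled (n : nat) (y : R) : 0 <= y -> y <= 2 ^+ n ->
    (expR y + expR (- y)) / 2 <= expR (2 * y ^+ 2).
  elim: n y => [|n IH] y y0 yn; first exact: small.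
  have h := IH (y / 2); move: h; rewrite exprS in yn.
  have -> : 2 * y ^+ 2 = (2 * (y / 2) ^+ 2) *+ 4 by field.
  set z := y / 2 => h.
  rewrite -[_ *+ 4]mulr_natl expRM_natl.
  have e1 : expR z * expR (- z) = 1 by rewrite -expRD subrr expR0.
  have -> : expR y = expR z * expR z by rewrite -expRD; congr expR; rewrite /z; lra.
  have -> : expR (- y) = expR (- z) * expR (- z).
    by rewrite -expRD; congr expR; rewrite /z; lra.
  have {}h : (expR z + expR (- z)) / 2 <= expR (2 * z ^+ 2) by apply: h; rewrite /z; lra.
  apply: (@le_trans _ _ (((expR z + expR (- z)) / 2) ^+ 4)); last first.
    by apply: lerXn2r; rewrite ?nnegrE ?expR_ge0// divr_ge0// addr_ge0 ?expR_ge0.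
  set c := (expR z + expR (- z)) / 2.
  have -> : (expR z * expR z + expR (- z) * expR (- z)) / 2 =
      2 * c ^+ 2 - expR z * expR (- z) by rewrite /c; lra.
  by rewrite e1; have := sqr_ge0 (c ^+ 2 - 1); nra.
have [n hn] : exists n, `|x| <= 2 ^+ n.
  exists (Num.trunc `|x|).+1; apply: (@le_trans _ _ (Num.trunc `|x|).+1%:R).
    by rewrite ltW// truncnS_gt.
  by rewrite -natrX ler_nat ltnW// ltn_expl.
have [x0|x0] := leP 0 x.
  by apply: (scaled n) => //; rewrite -(ger0_norm x0).
rewrite addrC -sqrrN -{2}(opprK x).
apply: (scaled n); first by rewrite oppr_ge0 ltW.
by rewrite -(ltr0_norm x0).
Qed.

(** The reflection along [z = e_i0 - v] exchanges the unit vectors [e_i0] and [v]; being symmetric,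
    it has [v] as its row [i0]. *)
Lemma householder {F : realFieldType} (n : nat) (v : 'cV[F]_n) (i0 : 'I_n) :
  \sum_i v i 0 ^+ 2 = 1 ->
  exists O : 'M[F]_n, O^T *m O = 1%:M /\ forall j, O i0 j = v j 0.
Proof.
move=> v1; pose z : 'cV[F]_n := delta_mx i0 0 - v.
pose N := \sum_i z i 0 ^+ 2; pose a := 2 / N.
have zE j : z j 0 = (j == i0)%:R - v j 0 by rewrite !mxE eqxx andbT.
have zz : z^T *m z = N%:M.
  apply/matrixP => i j; rewrite !ord1 !mxE eqxx mulr1n.
  by apply: eq_bigr => k _; rewrite mxE expr2.
(* If [v] is already the basis vector then [N = 0], so [a = 0] and the reflection degenerates to the
   identity, as wanted. *)
have aN : a * a * N = 2 * a.
  rewrite /a; have [->|N0] := eqVneq N 0; first by rewrite invr0 !(mulr0, mul0r).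
  by field.
have NE : N = 2 - 2 * v i0 0.
  rewrite /N; under eq_bigr => i _ do rewrite zE sqrrB expr2 -natrM mulnb andbb.
  rewrite big_split/= sumrB v1 (bigD1 i0)//= eqxx big1 => [|i /negbTE->//].
  rewrite (bigD1 i0)//= eqxx big1 => [|i /negbTE->]; last by rewrite mul0r mul0rn.
  by rewrite mul1r; ring.
exists (1%:M - a *: (z *m z^T)); split.
  have -> : (1%:M - a *: (z *m z^T))^T = 1%:M - a *: (z *m z^T).
    by rewrite linearB/= linearZ/= trmx1 trmx_mul trmxK.
  rewrite mulmxBl mul1mx mulmxBr mulmx1 -scalemxAl -scalemxAr scalerA.
  rewrite mulmxA -(mulmxA z) zz mul_mx_scalar -scalemxAl scalerA aN.
  have -> : a *: (z *m z^T) - (2 * a) *: (z *m z^T) = - (a *: (z *m z^T)).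
    by rewrite -scalerBl -scaleNr; congr (_ *: _); ring.
  by rewrite opprK subrK.
move=> j; move: zE NE aN {zz}; rewrite {}/a {}/N; move: z => z zE NE aN.
rewrite !mxE big_ord1 !mxE; move: NE {aN}; set N := \sum_i _ => NE.
have -> : 2 / N * (z i0 0 * z j 0) = z j 0.
  have [N0|N0] := eqVneq N 0.
    have : z j 0 ^+ 2 <= 0.
      by rewrite -N0 /N (bigD1 j)//= lerDl sumr_ge0// => i _; exact: sqr_ge0.
    rewrite le_eqVlt ltNge sqr_ge0 orbF sqrf_eq0 => /eqP->.
    by rewrite !mulr0.
  have -> : z i0 0 = N / 2 by rewrite NE zE eqxx mulr1n; field.
  by field.
by rewrite zE eq_sym opprB addrC subrK.
Qed.

Section sphere.
Context {R : realType} {d : measure_display} {T : measurableType d}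
  (P : probability T R) {n : nat} (X : T -> 'cV[R]_n) (r : R).
Hypothesis n0 : (0 < n)%N.
Hypothesis mX : forall i, measurable_fun setT (fun w => X w i 0).
Hypothesis unifX : uniform_sphere P X r.

Lemma measurable_dot (v : 'I_n -> R) :
  measurable_fun setT (fun w => \sum_i v i * X w i 0).
Proof. by apply: measurable_sum => i; exact: measurable_funM. Qed.

(** An orthogonal matrix with row [i0] equal to [v] makes the product with [v] a coordinate; a
    rectangle constraining this coordinate alone then turns invariance into equality of
    one-dimensional laws. *)
Lemma sphere_dot_law (v : 'I_n -> R) (i0 : 'I_n) (B : set R) :
  \sum_i v i ^+ 2 = 1 -> measurable B ->
  P [set w | B (\sum_i v i * X w i 0)] = P [set w | B (X w i0 0)].
Proof.
move=> v1 mB.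
have [|O [OO Ov]] := @householder R n (\col_i v i) i0.
  by under eq_bigr do rewrite mxE.
have [_ inv] := unifX.
pose B' i := if i == i0 then B else setT.
have mB' i : measurable (B' i) by rewrite /B'; case: eqP.
have := inv O OO B' mB'.
have B'E (x : 'cV[R]_n) : (forall i, B' i (x i 0)) = B (x i0 0).
  apply/propext; split=> [/(_ i0)|Bx i]; rewrite /B' ?eqxx//.
  by case: eqP => // ->.
have -> : [set w | forall i, B' i ((O *m X w) i 0)] =
          [set w | B (\sum_i v i * X w i 0)].
  apply/funext => w; rewrite /mkset B'E mxE; congr B.
  by apply: eq_bigr => i _; rewrite Ov mxE.
by move=> ->; congr (P _); apply/funext => w; rewrite /mkset B'E.
Qed.

Lemma sphere_dot_integral (v u : 'I_n -> R) (f : R -> \bar R) :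
  \sum_i v i ^+ 2 = 1 -> \sum_i u i ^+ 2 = 1 ->
  measurable_fun setT f -> (forall x, 0 <= f x)%E ->
  (\int[P]_w f (\sum_i v i * X w i 0)%R = \int[P]_w f (\sum_i u i * X w i 0)%R)%E.
Proof.
move=> v1 u1 mf f0.
pose v_ := isMeasurableFun.Build _ _ _ _ _ (measurable_dot v).
pose Yv : {mfun T >-> R} := HB.pack (fun w => \sum_i v i * X w i 0) v_.
pose u_ := isMeasurableFun.Build _ _ _ _ _ (measurable_dot u).
pose Yu : {mfun T >-> R} := HB.pack (fun w => \sum_i u i * X w i 0) u_.
transitivity (\int[distribution P Yv]_x f x)%E.
  by rewrite ge0_integral_pushforward.
transitivity (\int[distribution P Yu]_x f x)%E; last first.
  by rewrite ge0_integral_pushforward.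
apply: eq_measure_integral => B mB _.
have i0 : 'I_n := Ordinal n0.
transitivity (P [set w | B (X w i0 0)]); first exact: sphere_dot_law.
by apply/esym; exact: sphere_dot_law.
Qed.

Lemma sphere_norm_ae : {ae P, forall w, \sum_i X w i 0 ^+ 2 = r ^+ 2}.
Proof.
have mA : measurable [set w | \sum_i X w i 0 ^+ 2 = r ^+ 2].
  have mS : measurable_fun setT (fun w => \sum_i X w i 0 ^+ 2).
    by apply: measurable_sum => i; exact: measurable_funX.
  by have := mS measurableT _ (measurable_set1 (r ^+ 2)); rewrite setTI.
have [PA _] := unifX.
exists (~` [set w | \sum_i X w i 0 ^+ 2 = r ^+ 2]); split => //.
  exact: measurableC.
by have := probability_setC P mA; rewrite PA subee.
Qed.

(* All unit vectors give the same law, so [v] may be averaged over the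
   vectors with entries [± 1 / sqrt n]. *)
Lemma sphere_mgf (v : 'I_n -> R) (l : R) : \sum_i v i ^+ 2 = 1 ->
  (\int[P]_w (expR (l * \sum_i v i * X w i 0))%:E <=
   (expR (2 * l ^+ 2 * r ^+ 2 / n%:R))%:E)%E.
Proof.
move=> v1.
pose sq : R := (Num.sqrt n%:R)^-1.
have sq2 : sq ^+ 2 = n%:R^-1 by rewrite /sq exprVn sqr_sqrtr// ler0n.
have nR : n%:R != 0 :> R by rewrite pnatr_eq0 -lt0n.
pose sg (b : bool) : R := if b then 1 else -1.
pose u (e : {ffun 'I_n -> bool}) i : R := sg (e i) * sq.
have u1 e : \sum_i u e i ^+ 2 = 1.
  rewrite (eq_bigr (fun=> n%:R^-1)).
    by rewrite sumr_const card_ord -[LHS]mulr_natl divff.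
  by move=> i _; rewrite /u exprMn sq2 /sg; case: (e i); rewrite ?sqrrN expr1n mul1r.
have mexp : measurable_fun setT (fun x : R => (expR (l * x))%:E).
  apply/measurable_EFinP; apply: measurableT_comp => //; exact: measurable_funM.
set I := (\int[P]_w _)%E.
have Iu e : I = (\int[P]_w (expR (l * \sum_i u e i * X w i 0))%:E)%E.
  by apply: (sphere_dot_integral (f := fun x => (expR (l * x))%:E)).
have I0 : (0 <= I)%E by apply: integral_ge0 => w _; rewrite lee_fin expR_ge0.
set E := expR (2 * _ * _ / _).
pose k : R := (2 ^+ n)^-1.
have k0 : 0 <= k by rewrite invr_ge0 exprn_ge0.
have sumk : \sum_(e : {ffun 'I_n -> bool}) k = 1.
  rewrite sumr_const card_ffun card_bool card_ord -[LHS]mulr_natl natrX /k divff//.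
have mf e : measurable_fun setT (fun w => expR (l * \sum_i u e i * X w i 0)).
  by apply: measurableT_comp => //; apply: measurable_funM => //; exact: measurable_dot.
have -> : I = (\int[P]_w (\sum_e k * expR (l * \sum_i u e i * X w i 0))%:E)%E.
  under [RHS]eq_integral do rewrite -sumEFin.
  rewrite ge0_integral_sum//; first last.
  - by move=> e w _; rewrite lee_fin mulr_ge0// expR_ge0.
  - by move=> e; apply/measurable_EFinP; exact: measurable_funM.
  transitivity (\sum_(e : {ffun 'I_n -> bool}) k%:E * I)%E.
    by rewrite -ge0_sume_distrl ?sumEFin ?sumk ?mul1e.
  apply: eq_bigr => e _; rewrite (Iu e) -ge0_integralZl//.
  by apply/measurable_EFinP.
have -> : E%:E = (\int[P]_w (cst E%:E w))%E.
  by rewrite integral_cst//= probability_setT mule1.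
(* The bound on the averaged integrand uses the norm of [X], which is known almost surely. *)
apply: ae_ge0_le_integral => //.
- by move=> w _; rewrite lee_fin sumr_ge0// => e _; rewrite mulr_ge0// expR_ge0.
- apply/measurable_EFinP; apply: measurable_sum => e; exact: measurable_funM.
- by move=> w _; rewrite lee_fin expR_ge0.
apply: filterS sphere_norm_ae => w Xr _; rewrite lee_fin.
(* Expanding a product over all sign choices: the mean over sign vectors factors into hyperbolic
   cosines. *)
have -> : \sum_(e : {ffun 'I_n -> bool}) k * expR (l * \sum_i u e i * X w i 0) =
    \prod_(i < n) ((expR (l * sq * X w i 0) + expR (- (l * sq * X w i 0))) / 2).
  rewrite big_split/= prodr_const card_ord exprVn -/k mulrC -mulr_sumr; congr (_ * _).
  transitivity (\prod_(i < n) \sum_(b : bool) expR (l * (sg b * sq) * X w i 0)); last first.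
    by apply: eq_bigr => i _; rewrite big_bool /sg /= mul1r mulN1r mulrN mulNr.
  rewrite bigA_distr_bigA/=; apply: eq_bigr => e _.
  by rewrite mulr_sumr expR_sum; apply: eq_bigr => i _; rewrite mulrA.
apply: (@le_trans _ _ (\prod_(i < n) expR (2 * (l * sq * X w i 0) ^+ 2))).
  apply: ler_prod => i _; rewrite coshr_le_expR andbT.
  by rewrite divr_ge0// addr_ge0 ?expR_ge0.
rewrite -expR_sum ler_expR le_eqVlt; apply/orP; left; apply/eqP.
rewrite -Xr mulr_sumr mulr_suml; apply: eq_bigr => i _.
by rewrite !exprMn sq2; field.
Qed.

End sphere.

(* The direction [y] is independent of [X], so it may be frozen. *)
Lemma sphere_dot_tail {R : realType} {d} {T : measurableType d}
    (P : probability T R) {I : finType} (F : I -> set (set T))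
    (sF : forall i, sigma_algebra setT (F i)) (Fm : forall i, F i `<=` measurable)
    (indF : mutually_independent P F) (J J' : {set I}) (n : nat)
    (X : T -> 'cV[R]_n) (y : 'I_n -> T -> R) (r l s : R) :
  (0 < n)%N -> [disjoint J & J']%B ->
  (forall i, block_measurable F J (fun w => X w i 0)) ->
  (forall i, block_measurable F J' (y i)) ->
  uniform_sphere P X r -> 0 <= l ->
  (P [set w | (s * Num.sqrt (\sum_i y i w ^+ 2) < \sum_i y i w * X w i 0)%R] <=
   (expR (2 * l ^+ 2 * r ^+ 2 / n%:R - l * s))%:E)%E.
Proof.
move=> n0 dis mX my uX l0.
have meas K f : block_measurable F K f -> measurable_fun setT f.
  exact: (block_measurable_measurable Fm).
pose nm w := Num.sqrt (\sum_i y i w ^+ 2).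
have mnm : block_measurable F J' nm.
  apply: (bmeas_comp measurable_sqrtr); apply: measurable_sum => i.
  by apply: measurable_funX; exact: my.
(* The normalized direction; it is the zero vector where [y] vanishes, and that case is treated
   apart. *)
pose v i w := y i w * (nm w)^-1.
have mv i : block_measurable F J' (v i).
  by apply: measurable_funM; [exact: my|exact: (bmeas_comp measurable_invr)].
pose f (z : cylinderType F J * cylinderType F J') : \bar R :=
  (expR (l * \sum_i v i z.2 * X z.1 i 0))%:E.
have mf : measurable_fun setT f.
  apply/measurable_EFinP; apply: measurableT_comp => //; apply: measurable_funM => //.
  apply: measurable_sum => i; apply: measurable_funM.
    by apply: (measurableT_comp (mv i)); exact: measurable_snd.
  by apply: (measurableT_comp (mX i)); exact: measurable_fst.
have f0 z : (0 <= f z)%E by rewrite lee_fin expR_ge0.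
set B := expR (2 * _ * _ / _ - _).
have bound : (\int[P]_w f (w, w) <= (expR (2 * l ^+ 2 * r ^+ 2 / n%:R))%:E)%E.
  rewrite (ge0_integral_cylinders sF Fm indF dis mf f0).
  rewrite -[leRHS]mule1 -(@probability_setT _ _ _ P) -integral_cst//.
  apply: ge0_le_integral => //.
  - by move=> w _; exact: integral_ge0.
  - exact: measurable_integral_cylinders.
  - move=> w _ /=; rewrite /f /=.
    have [nm0|nmn0] := eqVneq (nm w) 0.
      rewrite (eq_integral (cst 1%:E)); last first.
        move=> w' _ /=; rewrite big1 ?mulr0 ?expR0// => i _.
        by rewrite /v nm0 invr0 mulr0 mul0r.
      rewrite integral_cst//= probability_setT mule1 lee_fin -expR0 ler_expR.
      by rewrite divr_ge0// mulr_ge0// ?sqr_ge0// mulr_ge0// sqr_ge0.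
    apply: (sphere_mgf n0 _ uX) => [i|]; first exact: meas.
    rewrite /v; under eq_bigr do rewrite exprMn.
    rewrite -mulr_suml exprVn /nm sqr_sqrtr ?divff//.
      by apply: contra_neq nmn0 => h; rewrite /nm h sqrtr0.
    by apply: sumr_ge0 => i _; exact: sqr_ge0.
set E := [set w | _].
have mE : measurable E.
  apply: measurable_set_ltr.
    by apply: measurable_funM => //; exact: meas mnm.
  apply: measurable_sum => i; apply: measurable_funM.
    exact: meas (my i).
  exact: meas (mX i).
have mfd : measurable_fun setT (fun w : T => f (w, w)).
  apply/measurable_EFinP; apply: measurableT_comp => //; apply: measurable_funM => //.
  apply: measurable_sum => i; apply: measurable_funM.
    exact: meas (mv i).
  exact: meas (mX i).
apply: (@le_trans _ _ (\int[P]_w ((expR (- (l * s)))%:E * f (w, w)))%E).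
  have <- : (\int[P]_w (\1_E w)%:E = P E)%E by rewrite integral_indic// setIT.
  apply: ge0_le_integral => //.
  - by apply/measurable_EFinP; exact: measurable_indic.
  - exact: emeasurable_funM.
  - move=> w _; rewrite /f /= -EFinM lee_fin indicE.
    have [/set_mem Ew|_] := boolP (w \in E); last by rewrite mulr_ge0 ?expR_ge0.
    (* The strict inequality defining the event forces [y] to be nonzero, since otherwise both of
       its sides would be zero. *)
    have nmw : 0 < nm w.
      rewrite lt_def sqrtr_ge0 andbT; apply/eqP => nm0.
      move: Ew; rewrite /E /= -/(nm w) nm0 mulr0 big1 ?ltxx// => i _.
      have /eqP : \sum_i y i w ^+ 2 = 0.
        by apply/eqP; rewrite eq_le sumr_ge0 ?andbT -?sqrtr_eq0 -/(nm w) ?nm0// => j _;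
          exact: sqr_ge0.
      rewrite psumr_eq0 => [/allP/(_ i)|j _]; last exact: sqr_ge0.
      by rewrite mem_index_enum sqrf_eq0 => /(_ isT)/eqP ->; rewrite mul0r.
    rewrite -expRD -expR0 ler_expR addrC -mulrBr mulr_ge0// subr_ge0.
    have -> : \sum_i v i w * X w i 0 = (\sum_i y i w * X w i 0) / nm w.
      by rewrite mulr_suml; apply: eq_bigr => i _; rewrite /v mulrAC.
    by rewrite ler_pdivlMr// ltW.
rewrite ge0_integralZl//.
have -> : B = expR (- (l * s)) * expR (2 * l ^+ 2 * r ^+ 2 / n%:R).
  by rewrite /B -expRD addrC.
by rewrite EFinM lee_wpmul2l// lee_fin expR_ge0.
Qed.

(** * The statistic as a sum of squares *)

Section complex_parts.
Context {R : rcfType}.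
Implicit Types x y z : R[i].

Lemma ReD x y : complex.Re (x + y) = complex.Re x + complex.Re y.
Proof. by case: x; case: y. Qed.

Lemma ImD x y : complex.Im (x + y) = complex.Im x + complex.Im y.
Proof. by case: x; case: y. Qed.

Lemma ReM x y :
  complex.Re (x * y) = complex.Re x * complex.Re y - complex.Im x * complex.Im y.
Proof. by case: x; case: y. Qed.

Lemma ImM x y :
  complex.Im (x * y) = complex.Re x * complex.Im y + complex.Im x * complex.Re y.
Proof. by case: x; case: y. Qed.

Lemma Re_conjc x : complex.Re (conjc x) = complex.Re x.
Proof. by case: x. Qed.

Lemma Im_conjc x : complex.Im (conjc x) = - complex.Im x.
Proof. by case: x. Qed.

Lemma Re_sum (I : Type) (s : seq I) (p : pred I) (f : I -> R[i]) :
  complex.Re (\sum_(i <- s | p i) f i) = \sum_(i <- s | p i) complex.Re (f i).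
Proof. by apply: big_morph => //; exact: ReD. Qed.

Lemma Im_sum (I : Type) (s : seq I) (p : pred I) (f : I -> R[i]) :
  complex.Im (\sum_(i <- s | p i) f i) = \sum_(i <- s | p i) complex.Im (f i).
Proof. by apply: big_morph => //; exact: ImD. Qed.

Lemma Re_natV (n : nat) x : complex.Re (n%:R^-1 * x) = n%:R^-1 * complex.Re x.
Proof.
have -> : n%:R^-1 = Complex (n%:R^-1) 0 :> R[i].
  have -> : n%:R = Complex n%:R 0 :> R[i] by rewrite -(rmorph_nat (real_complex R)).
  by rewrite -[RHS]/((n%:R^-1)%:C%C) fmorphV.
by rewrite ReM mul0r subr0.
Qed.

Lemma mul_conjc_eq x : x * conjc x = Complex (complex.Re x ^+ 2 + complex.Im x ^+ 2) 0.
Proof. by case: x => a b; apply/eqP; rewrite eq_complex /=; apply/andP; split; apply/eqP; ring. Qed.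

End complex_parts.

Section statistic.
Context {R : realType} {D N M : nat}.
Implicit Types (a : 'I_N -> 'cV[R[i]]_D) (Y : 'M[R[i]]_(D, M)) (gam : 'I_N -> R).

(** The product [a_k^* y_m], where [y_m] is column [m] of [Y]. *)
Definition proj a Y (k : 'I_N) (m : 'I_M) : R[i] :=
  \sum_i conjc (a k i 0) * Y i m.

(** The quadratic form of [Y Y^* / M] at [a_k] is the mean over the columns of [|a_k^* y_m|^2]. *)
Lemma Re_calY a Y k : complex.Re (calY a Y k) =
  M%:R^-1 * \sum_m (complex.Re (proj a Y k m) ^+ 2 + complex.Im (proj a Y k m) ^+ 2).
Proof.
have -> : calY a Y k = M%:R^-1 * \sum_m proj a Y k m * conjc (proj a Y k m).
  transitivity (\sum_i \sum_j \sum_m M%:R^-1 *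
      ((conjc (a k i 0) * Y i m) * (a k j 0 * conjc (Y j m)))).
    apply: eq_bigr => i _; apply: eq_bigr => j _.
    rewrite /Sigma_hat !mxE !mulr_sumr; apply: eq_bigr => m _.
    by rewrite !mxE; ring.
  rewrite mulr_sumr; under eq_bigr do rewrite exchange_big/=.
  rewrite exchange_big/=; apply: eq_bigr => m _.
  rewrite /proj rmorph_sum/= mulr_suml mulr_sumr; apply: eq_bigr => i _.
  rewrite mulr_sumr mulr_sumr; apply: eq_bigr => j _.
  by rewrite rmorphM/= conjcK; ring.
rewrite Re_natV Re_sum; congr (_ * _); apply: eq_bigr => m _.
by rewrite mul_conjc_eq.
Qed.

(** [ipr] and [ipi] are the real and imaginary parts of [a_k^* a_l]. *)
Definition ipr a (k l : 'I_N) : R := \sum_i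
  (complex.Re (a k i 0) * complex.Re (a l i 0) +
   complex.Im (a k i 0) * complex.Im (a l i 0)).

Definition ipi a (k l : 'I_N) : R := \sum_i
  (complex.Re (a k i 0) * complex.Im (a l i 0) -
   complex.Im (a k i 0) * complex.Re (a l i 0)).

Definition nsq a (k : 'I_N) : R :=
  \sum_i (complex.Re (a k i 0) ^+ 2 + complex.Im (a k i 0) ^+ 2).

(** Indices of the real Gaussian variables that enter one column of [Y]. *)
Definition source : finType := (('I_N * bool) + ('I_D * bool))%type.

(* Coefficients of the real ([b = true]) or imaginary part of [a_k^* y_m] on the
   real and imaginary parts of the entries of column [m] of [H] and of [Z]. *)
Definition coef gam a (k : 'I_N) (b : bool) (l : source) : R :=
  match l with
  | inl (n, b') =>
      Num.sqrt (gam n) *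
      (if b then (if b' then ipr a k n else - ipi a k n)
       else (if b' then ipi a k n else ipr a k n))
  | inr (i, b') =>
      if b then (if b' then complex.Re (a k i 0) else complex.Im (a k i 0))
      else (if b' then - complex.Im (a k i 0) else complex.Re (a k i 0))
  end.

Definition gaussians (H : 'M[R[i]]_(N, M)) (Z : 'M[R[i]]_(D, M)) (m : 'I_M)
    (l : source) : R :=
  match l with
  | inl (n, b) => part b (H n m)
  | inr (i, b) => part b (Z i m)
  end.

Definition variances (sigma : R) (l : source) : R :=
  if l is inl _ then 1 / 2 else sigma ^+ 2 / 2.

Lemma big_source (f : source -> R) : \sum_l f l =
  \sum_n (f (inl (n, true)) + f (inl (n, false))) +
  \sum_i (f (inr (i, true)) + f (inr (i, false))).
Proof.
rewrite big_sumType/=; congr (_ + _).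
  rewrite (eq_bigr (fun p => f (inl (p.1, p.2)))) => [|[]//].
  by rewrite -(pair_bigA _ (fun i b => f (inl (i, b))))/=; apply: eq_bigr => n _; rewrite big_bool.
rewrite (eq_bigr (fun p => f (inr (p.1, p.2)))) => [|[]//].
by rewrite -(pair_bigA _ (fun i b => f (inr (i, b))))/=; apply: eq_bigr => n _; rewrite big_bool.
Qed.

Lemma proj_obsY gam a H Z k m : proj a (obsY gam a H Z) k m =
  Complex (\sum_l coef gam a k true l * gaussians H Z m l)
          (\sum_l coef gam a k false l * gaussians H Z m l).
Proof.
pose ip n := \sum_i conjc (a k i 0) * a n i 0.
have ipE n : ip n = Complex (ipr a k n) (ipi a k n).
  apply/eqP; rewrite eq_complex /=; apply/andP; split; apply/eqP.
    rewrite Re_sum; apply: eq_bigr => i _; rewrite ReM Re_conjc Im_conjc; ring.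
  rewrite Im_sum; apply: eq_bigr => i _; rewrite ImM Re_conjc Im_conjc; ring.
have -> : proj a (obsY gam a H Z) k m =
    \sum_n (Complex (Num.sqrt (gam n)) 0 * ip n * H n m) +
    \sum_i conjc (a k i 0) * Z i m.
  rewrite /proj; under eq_bigr => i _ do rewrite /obsY !mxE mulrDr.
  rewrite big_split/=; congr (_ + _).
  transitivity (\sum_i \sum_n conjc (a k i 0) * (a n i 0 * Complex (Num.sqrt (gam n)) 0 * H n m)).
    apply: eq_bigr => i _; rewrite mulr_sumr; apply: eq_bigr => n _.
    by rewrite mul_mx_diag !mxE.
  rewrite exchange_big/=; apply: eq_bigr => n _.
  by rewrite /ip mulr_sumr mulr_suml; apply: eq_bigr => i _; ring.
apply/eqP; rewrite eq_complex /=; apply/andP; split; apply/eqP.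
  rewrite ReD !Re_sum big_source /=; congr (_ + _); apply: eq_bigr => n _.
    by rewrite ipE !(ReM, ImM)/=; ring.
  by rewrite ReM Re_conjc Im_conjc; ring.
rewrite ImD !Im_sum big_source /=; congr (_ + _); apply: eq_bigr => n _.
  by rewrite ipE !(ReM, ImM)/=; ring.
by rewrite ImM Re_conjc Im_conjc; ring.
Qed.

(** The real and imaginary parts have the same coefficients up to order and sign, so each carries
    half of the variance [s_k]. *)
Lemma coef_variance sigma gam a k b : (forall n, 0 <= gam n) ->
  \sum_l coef gam a k b l ^+ 2 * variances sigma l =
  (\sum_n gam n * (ipr a k n ^+ 2 + ipi a k n ^+ 2) + sigma ^+ 2 * nsq a k) / 2.
Proof.
move=> gam0; rewrite big_source /= mulrDl mulr_suml mulr_sumr mulr_suml.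
congr (_ + _); apply: eq_bigr => n _; last by case: b => /=; field.
by rewrite !exprMn sqr_sqrtr//; case: b; field.
Qed.

End statistic.

(** * The two Gaussian tail bounds *)

Section model_tails.
Context {R : realType} {d : measure_display} {T : measurableType d}
  (P : probability T R) {D N M : nat} (sigma : R).
Variables (a : 'I_N -> T -> 'cV[R[i]]_D) (H : T -> 'M[R[i]]_(N, M))
  (Z : T -> 'M[R[i]]_(D, M)).
Hypotheses (D0 : (0 < D)%N) (N0 : (0 < N)%N) (M0 : (0 < M)%N).
Hypothesis md : model P sigma a H Z.
Variable gam : 'I_N -> R.
Hypothesis gam0 : forall k, 0 <= gam k.

Local Notation F := (model_sigma a H Z).
Local Notation A := (fun w k => a k w).
Local Notation bmeas := (block_measurable F).

Lemma model_sigma_algebra i : sigma_algebra setT (F i).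
Proof. by case: i => [k|[[[n m] b]|[[i m] b]]]; exact: smallest_sigma_algebra. Qed.

Lemma model_sigma_measurable i : F i `<=` measurable.
Proof.
have [[ma mH mZ] _ _ _ _] := md.
by case: i => [k|[[[n m] b]|[[i m] b]]];
  apply: (smallest_sub (@sigma_algebra_measurable _ T)) => _ [j [B [mB ->]]];
  rewrite -[X in measurable X]setTI; [apply: ma|apply: mH|apply: mZ].
Qed.

Lemma model_indep : mutually_independent P F.
Proof. by have [] := md. Qed.

(** Measurability with respect to these blocks plays the role of conditioning on the vectors
    [a_k]. *)
Definition vector_blocks : {set block_index D N M} :=
  [set b | if b is inl _ then true else false]%SET.

Definition gaussian_block (m : 'I_M) (l : source (D := D) (N := N)) : block_index D N M :=
  match l with
  | inl (n, b) => inr (inl (n, m, b))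
  | inr (i, b) => inr (inr (i, m, b))
  end.

Lemma gaussian_block_inj m m' l l' :
  gaussian_block m l = gaussian_block m' l' -> m = m' /\ l = l'.
Proof. by case: l => [[? ?]|[? ?]]; case: l' => [[? ?]|[? ?]] //= [-> -> ->]. Qed.

Lemma gaussian_block_notin m l : gaussian_block m l \notin vector_blocks.
Proof. by case: l => [[? ?]|[? ?]]; rewrite finset.inE. Qed.

Lemma gaussians_block m l B : measurable B ->
  F (gaussian_block m l) ((fun w => gaussians (H w) (Z w) m l) @^-1` B).
Proof.
by move=> mB; case: l => [[? ?]|[? ?]]; apply: sub_sigma_algebra; exists tt, B.
Qed.

Lemma gaussians_normal m l :
  real_normal P (fun w => gaussians (H w) (Z w) m l) 0 (variances sigma l).
Proof.
have [_ _ hH hZ _] := md.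
by case: l => [[n []]|[i []]] /=; [have [] := hH n m|have [] := hH n m|
  have [] := hZ i m|have [] := hZ i m].
Qed.

Lemma variances_ge0 (l : source (D := D) (N := N)) : 0 <= variances sigma l.
Proof. by case: l => _ /=; rewrite divr_ge0// sqr_ge0. Qed.

Lemma entry_bmeas (J : {set block_index D N M}) k i b : inl k \in J ->
  bmeas J (fun w => part b (a k w i 0)).
Proof.
move=> kJ; apply: (block_measurable_of model_sigma_algebra kJ) => B mB.
by apply: sub_sigma_algebra; exists (i, b), B.
Qed.

Lemma inl_vector_blocks k : inl k \in vector_blocks.
Proof. by rewrite finset.inE. Qed.

Let Re_bmeas k i := entry_bmeas i true (inl_vector_blocks k).
Let Im_bmeas k i := entry_bmeas i false (inl_vector_blocks k).

Lemma ipr_bmeas k l : bmeas vector_blocks (fun w => ipr (A w) k l).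
Proof.
apply: measurable_sum => i; apply: measurable_funD; apply: measurable_funM.
all: by [exact: Re_bmeas|exact: Im_bmeas].
Qed.

Lemma ipi_bmeas k l : bmeas vector_blocks (fun w => ipi (A w) k l).
Proof.
apply: measurable_sum => i; apply: measurable_funB; apply: measurable_funM.
all: by [exact: Re_bmeas|exact: Im_bmeas].
Qed.

Lemma nsq_bmeas k : bmeas vector_blocks (fun w => nsq (A w) k).
Proof.
apply: measurable_sum => i; apply: measurable_funD; apply: measurable_funX.
all: by [exact: Re_bmeas|exact: Im_bmeas].
Qed.

Lemma coef_bmeas k b l : bmeas vector_blocks (fun w => coef gam (A w) k b l).
Proof.
case: l => [[n []]|[i []]]; case: b => /=.
1-4: apply: measurable_funM => //.
all: try exact: Re_bmeas.
all: try exact: Im_bmeas.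
all: try exact: ipr_bmeas.
all: try exact: ipi_bmeas.
- by apply: measurableT_comp => //; exact: ipi_bmeas.
- by apply: measurableT_comp => //; exact: Im_bmeas.
Qed.

Definition row_energy (k : 'I_N) (b : bool) (w : T) : R :=
  \sum_m (\sum_l coef gam (A w) k b l * gaussians (H w) (Z w) m l) ^+ 2.

(** This is the variance [s_k = a_k^* Sigma a_k]. *)
Definition signal (w : T) (k : 'I_N) : R :=
  \sum_n gam n * (ipr (A w) k n ^+ 2 + ipi (A w) k n ^+ 2) + sigma ^+ 2 * nsq (A w) k.

Definition stat (w : T) (k : 'I_N) : R :=
  complex.Re (calY (A w) (obsY gam (A w) (H w) (Z w)) k).

Lemma statE w k : stat w k = M%:R^-1 * (row_energy k true w + row_energy k false w).
Proof.
rewrite /stat Re_calY /row_energy -big_split/=; congr (_ * _).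
by apply: eq_bigr => m _; rewrite proj_obsY.
Qed.

Lemma signal_bmeas k : bmeas vector_blocks (signal ^~ k).
Proof.
apply: measurable_funD; last by apply: measurable_funM => //; exact: nsq_bmeas.
apply: measurable_sum => n; apply: measurable_funM => //.
apply: measurable_funD; apply: measurable_funX; [exact: ipr_bmeas|exact: ipi_bmeas].
Qed.

Let meas (f : T -> R) : bmeas vector_blocks f -> measurable_fun setT f.
Proof. exact: (block_measurable_measurable model_sigma_measurable). Qed.

Lemma row_energy_measurable k b : measurable_fun setT (row_energy k b).
Proof.
apply: measurable_sum => m; apply: measurable_funX; apply: measurable_sum => l.
apply: measurable_funM; first exact: meas (coef_bmeas k b l).
move=> _ B mB; rewrite setTI; apply: model_sigma_measurable.
exact: gaussians_block mB.
Qed.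

Lemma stat_measurable k : measurable_fun setT (stat ^~ k).
Proof.
under eq_fun do rewrite statE.
by apply: measurable_funM => //; apply: measurable_funD; exact: row_energy_measurable.
Qed.

(** The [M] columns are the independent copies in [chernoff_rows], and [row] selects which real or
    imaginary parts of the products [a_k^* y_m] are summed. *)
Lemma stat_chernoff (Rw : finType) (row : Rw -> 'I_N * bool) (s' : Rw -> T -> R)
    (E : set T) (t u : R) :
  (forall r, bmeas vector_blocks (s' r)) ->
  @measurable _ (cylinderType F vector_blocks) E -> (0 < #|Rw|)%N ->
  (forall r w, 0 < s' r w) -> t <= 4^-1 ->
  (forall r w, E w -> t * (signal w (row r).1 / 2) <= t * s' r w) ->
  (P (E `&` [set w | (t * (u * M%:R * \sum_r s' r w) <=
      t * \sum_r row_energy (row r).1 (row r).2 w)%R]) <=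
    (expR (M%:R * (t + 4 * t ^+ 2 - t * u)))%:E)%E.
Proof.
move=> ms' mE R0 s'0 t4 hE.
have := @chernoff_rows _ _ _ P _ F model_sigma_algebra model_sigma_measurable
  model_indep 'I_M (source (D := D) (N := N)) Rw gaussian_block
  (fun m l w => gaussians (H w) (Z w) m l) (variances sigma) vector_blocks
  gaussian_block_inj gaussian_block_notin gaussians_block gaussians_normal
  variances_ge0 (fun r l w => coef gam (A w) (row r).1 (row r).2 l) s' E t u.
rewrite card_ord; apply => //.
- by move=> r l; exact: coef_bmeas.
- by move=> r w Ew; rewrite coef_variance//; exact: hE.
Qed.

(** Only the term [n = k], where [a_k^* a_k = D], is kept of the sum. *)
Lemma signal_ge w k : nsq (A w) k = D%:R ->
  gam k * D%:R ^+ 2 + sigma ^+ 2 * D%:R <= signal w k.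
Proof.
move=> nk; rewrite /signal nk lerD2r (bigD1 k)//=.
have -> : ipr (A w) k k = D%:R by rewrite -nk; apply: eq_bigr => i _; rewrite !expr2.
rewrite -[leLHS]addr0 lerD//; last first.
  by apply: sumr_ge0 => n _; rewrite mulr_ge0// addr_ge0 ?sqr_ge0.
by rewrite ler_wpM2l// lerDl sqr_ge0.
Qed.

(** Two rows, the real and imaginary parts for [k], with the constant proxy [s0 / 2], which lies
    below the true variance by [signal_ge]; a lower tail takes a negative [t]. *)
Lemma stat_lower_tail k (g dl : R) : 0 < g <= gam k -> 0 < dl <= 1 ->
  (P ([set w | nsq (A w) k = D%:R] `&`
      [set w | (stat w k <= (1 - dl) * (g * D%:R ^+ 2 + sigma ^+ 2 * D%:R))%R]) <=
   (expR (- (M%:R * dl ^+ 2 / 16)))%:E)%E.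
Proof.
move=> /andP[g0 gk] /andP[dl0 dl1].
set s0 := g * _ + _.
have DR : 0 < D%:R :> R by rewrite ltr0n.
have MR : 0 < M%:R :> R by rewrite ltr0n.
have s00 : 0 < s0.
  by rewrite ltr_pwDl ?mulr_gt0 ?exprn_gt0// mulr_ge0 ?sqr_ge0// ltW.
(* With [t = - dl / 8] and [u = 1 - dl] the exponent [t + 4 t^2 - t u] equals [- dl^2 / 16]. *)
have := @stat_chernoff bool (fun b => (k, b)) (fun _ _ => s0 / 2)
  [set w | nsq (A w) k = D%:R] (- dl / 8) (1 - dl).
set B := [set w | (_ * _ <= _)%R].
have -> : B = [set w | stat w k <= (1 - dl) * s0].
  apply/funext => w; rewrite /B /mkset !big_bool /= statE; apply/propext.
  rewrite mulNr !mulNr lerN2 ler_pM2l ?divr_gt0//.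
  rewrite ler_pdivrMl//.
  by have -> : (1 - dl) * M%:R * (s0 / 2 + s0 / 2) = M%:R * ((1 - dl) * s0) by field.
have -> : M%:R * (- dl / 8 + 4 * (- dl / 8) ^+ 2 - - dl / 8 * (1 - dl)) =
  - (M%:R * dl ^+ 2 / 16) by field.
have mE : @measurable _ (cylinderType F vector_blocks) [set w | nsq (A w) k = D%:R].
  rewrite -[X in measurable X]setTI.
  exact: (nsq_bmeas k measurableT (measurable_set1 D%:R)).
move=> h; apply: h => //.
- by move=> _; exact: measurable_cst.
- by rewrite card_bool.
- by move=> _ _; rewrite divr_gt0.
- lra.
- move=> b w /= nk; rewrite ler_wnM2l//; first by lra.
  rewrite ler_pM2r ?invr_gt0//; apply: le_trans (signal_ge nk).
  by rewrite lerD2r ler_wpM2r// exprn_ge0// ltW.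
Qed.

(** All [2 N] rows enter a single Chernoff bound, so [N] does not appear in the probability. The
    slack [eta] keeps the proxies positive where [signal] vanishes. *)
Lemma mean_upper_tail (eta dl : R) : 0 < eta -> 0 < dl <= 1 ->
  (P [set w | ((1 + dl) * (N%:R^-1 * (\sum_k signal w k) + 2 * eta) <=
       N%:R^-1 * \sum_k stat w k)%R] <= (expR (- (M%:R * dl ^+ 2 / 16)))%:E)%E.
Proof.
move=> eta0 /andP[dl0 dl1].
have NR : 0 < N%:R :> R by rewrite ltr0n.
have MR : 0 < M%:R :> R by rewrite ltr0n.
have sg0 w k : 0 <= signal w k.
  rewrite addr_ge0//.
    by apply: sumr_ge0 => n _; rewrite mulr_ge0// addr_ge0 ?sqr_ge0.
  rewrite mulr_ge0 ?sqr_ge0//; apply: sumr_ge0 => i _; rewrite addr_ge0 ?sqr_ge0//.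
have := @stat_chernoff ('I_N * bool)%type id (fun r w => signal w r.1 / 2 + eta)
  setT (dl / 8) (1 + dl).
set B := [set w | (_ * _ <= _)%R].
have -> : B = [set w | (1 + dl) * (N%:R^-1 * (\sum_k signal w k) + 2 * eta) <=
       N%:R^-1 * \sum_k stat w k].
  apply/funext => w; rewrite /B /mkset; apply/propext.
  rewrite ler_pM2l ?divr_gt0//.
  rewrite -(pair_bigA _ (fun k b => signal w k / 2 + eta))/=.
  rewrite -(pair_bigA _ (fun k b => row_energy k b w))/=.
  under eq_bigr do rewrite big_bool/=.
  under [X in _ <= X]eq_bigr do rewrite big_bool/=.
  have -> : \sum_k (signal w k / 2 + eta + (signal w k / 2 + eta)) =
      N%:R * (N%:R^-1 * (\sum_k signal w k) + 2 * eta).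
    transitivity (\sum_k (signal w k + 2 * eta)).
      by apply: eq_bigr => k _; field.
    rewrite big_split/= sumr_const card_ord -[_ *+ N]mulr_natl.
    by rewrite mulrDr mulVKf// gt_eqF.
  have -> : \sum_k (row_energy k true w + row_energy k false w) =
      M%:R * \sum_k stat w k.
    by rewrite mulr_sumr; apply: eq_bigr => k _; rewrite statE mulVKf// gt_eqF.
  set X := N%:R^-1 * _ + _; set Y := \sum_k stat w k.
  rewrite ler_pdivlMl// -(ler_pM2l MR (N%:R * _)).
  by have -> : M%:R * (N%:R * ((1 + dl) * X)) = (1 + dl) * M%:R * (N%:R * X) by ring.
have -> : M%:R * (dl / 8 + 4 * (dl / 8) ^+ 2 - dl / 8 * (1 + dl)) =
  - (M%:R * dl ^+ 2 / 16) by field.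
rewrite setTI => h; apply: h => //.
- move=> r; apply: measurable_funD => //; apply: measurable_funM => //.
  exact: signal_bmeas.
- by rewrite card_prod card_bool card_ord muln_gt0 N0.
- by move=> r w; rewrite ltr_wpDl// divr_ge0.
- lra.
- by move=> r w _; rewrite ler_pM2l ?divr_gt0// lerDl ltW.
Qed.

End model_tails.

(** * Correlations of the columns *)

Lemma measure_bigsetU_le {R : realType} {d} {T : measurableType d}
    (mu : {measure set T -> \bar R}) (I : Type) (s : seq I) (p : pred I) (A : I -> set T) :
  (forall i, measurable (A i)) ->
  (mu (\big[setU/set0]_(i <- s | p i) A i) <= \sum_(i <- s | p i) mu (A i))%E.
Proof.
move=> mA; elim: s => [|i s IH]; first by rewrite !big_nil measure0.
rewrite !big_cons; case: (p i) => //.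
apply: (le_trans (measureU2 _ (mA i) _)); last by rewrite leeD2l.
exact: bigsetU_measurable.
Qed.

Section pairs.
Context {R : realType} {d : measure_display} {T : measurableType d}
  (P : probability T R) {D N M : nat} (sigma : R).
Variables (a : 'I_N -> T -> 'cV[R[i]]_D) (H : T -> 'M[R[i]]_(N, M))
  (Z : T -> 'M[R[i]]_(D, M)).
Hypotheses (D0 : (0 < D)%N).
Hypothesis md : model P sigma a H Z.
Local Notation F := (model_sigma a H Z).
Local Notation A := (fun w k => a k w).

(** The four signed parts of [a_k^* a_l]; one-sided bounds on all of them bound the modulus. *)
Definition ip_part (w : T) (k l : 'I_N) (b1 b2 : bool) : R :=
  (if b2 then 1 else -1) * (if b1 then ipr (A w) k l else ipi (A w) k l).

Lemma nsqE w k : nsq (A w) k = \sum_i realify (a k w) i 0 ^+ 2.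
Proof.
rewrite big_split_ord/= -big_split/=; apply: eq_bigr => i _.
by rewrite /realify col_mxEu col_mxEd !mxE.
Qed.

Lemma nsq_ae k : {ae P, forall w, nsq (A w) k = D%:R}.
Proof.
have [[ma _ _] uX _ _ _] := md.
have m i : measurable_fun setT (fun w => realify (a k w) i 0).
  rewrite -(splitK i); case: (fintype.split i) => j /=.
    by under eq_fun do [rewrite /realify col_mxEu mxE]; exact: (ma k j true).
  by under eq_fun do [rewrite /realify col_mxEd mxE]; exact: (ma k j false).
apply: filterS (sphere_norm_ae m (uX k)) => w.
by rewrite -nsqE sqr_sqrtr.
Qed.

(* The vector of R^(2D) whose inner product with [realify a_k] is the chosen
   signed part of [a_k^* a_l]. *)
Definition dual_dir (l : 'I_N) (b1 b2 : bool) (i : 'I_(D + D)) (w : T) : R :=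
  (if b2 then 1 else -1) *
  match fintype.split i with
  | inl j => if b1 then complex.Re (a l w j 0) else complex.Im (a l w j 0)
  | inr j => if b1 then complex.Im (a l w j 0) else - complex.Re (a l w j 0)
  end.

(** [dual_dir l] has the norm of [a_l] and is independent of [a_k], so [sphere_dot_tail] applies in
    dimension [2 D] with radius [sqrt D]. *)
Lemma pair_tail (k l : 'I_N) (b1 b2 : bool) (s : R) : k != l -> 0 <= s ->
  (P [set w | (s * Num.sqrt (nsq (A w) l) < ip_part w k l b1 b2)%R] <=
   (expR (- (s ^+ 2 / 4)))%:E)%E.
Proof.
move=> kl s0.
have [[ma _ _] uX _ _ _] := md.
have DR : D%:R != 0 :> R by rewrite pnatr_eq0 -lt0n.
have splitl (j : 'I_D) : fintype.split (lshift D j) = inl j := unsplitK (inl j).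
have splitr (j : 'I_D) : fintype.split (rshift D j) = inr j := unsplitK (inr j).
have n0 : (0 < D + D)%N by rewrite addn_gt0 D0.
pose J : {set block_index D N M} := [set inl k]%SET.
pose J' : {set block_index D N M} := [set inl l]%SET.
have dis : [disjoint J & J']%B.
  by rewrite disjoints1 finset.in_set1; apply: contra kl => /eqP[->].
have mX i : block_measurable F J (fun w => realify (a k w) i 0).
  have kJ : inl k \in J by rewrite finset.in_set1.
  rewrite -(splitK i); case: (fintype.split i) => j /=.
    by under eq_fun do [rewrite /realify col_mxEu mxE]; exact (entry_bmeas j true kJ).
  by under eq_fun do [rewrite /realify col_mxEd mxE]; exact (entry_bmeas j false kJ).
have my i : block_measurable F J' (dual_dir l b1 b2 i).
  have lJ : inl l \in J' by rewrite finset.in_set1.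
  apply: measurable_funM => //; case: (fintype.split i) => j; case: b1.
  - exact: (entry_bmeas j true lJ).
  - exact: (entry_bmeas j false lJ).
  - exact: (entry_bmeas j false lJ).
  - by apply: measurableT_comp => //; exact: (entry_bmeas j true lJ).
(* Here [r^2 / n = 1 / 2], so the exponent is [l^2 - l s], minimal at [l = s / 2]. *)
have l0 : 0 <= s / 2 by rewrite divr_ge0.
have := sphere_dot_tail (model_sigma_algebra a H Z) (model_sigma_measurable md)
  (model_indep md) s n0 dis mX my (uX k) l0.
have -> : 2 * (s / 2) ^+ 2 * Num.sqrt D%:R ^+ 2 / (D + D)%:R - s / 2 * s =
    - (s ^+ 2 / 4).
  by rewrite sqr_sqrtr// natrD; field; rewrite -natrD pnatr_eq0 addn_eq0 andbb -lt0n.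
set E := [set w | _]; set E' := [set w | _].
suff -> : E = E' by [].
apply/funext => w; rewrite /E /E' /mkset; congr (_ * Num.sqrt _ < _).
  rewrite big_split_ord/= -big_split/=; apply: eq_bigr => j _.
  rewrite /dual_dir splitl splitr !exprMn.
  have -> : (if b2 then 1 else -1 : R) ^+ 2 = 1 by case: (b2); rewrite ?sqrrN expr1n.
  by case: (b1); rewrite !mul1r// sqrrN addrC.
rewrite big_split_ord/= -big_split/= /ip_part /ipr /ipi; case: (b1); rewrite mulr_sumr;
  apply: eq_bigr => j _;
  by rewrite /dual_dir splitl splitr /realify col_mxEu col_mxEd !mxE; ring.
Qed.

End pairs.

(** * Separation of the support *)

Section gam_extrema.
Context {R : realType} {N : nat} (gam : 'I_N -> R).
Hypothesis gam0 : forall k, 0 <= gam k.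

Lemma gam_le_max k : gam k <= gam_max gam.
Proof.
have [kS|] := boolP (k \in supp gam); first exact: le_bigmax_cond.
rewrite finset.inE negbK => /eqP->.
by rewrite /gam_max; elim/big_ind: _ => // x y x0 y0; rewrite le_max x0.
Qed.

Lemma gam_min_le k : k \in supp gam -> gam_min gam <= gam k.
Proof. by move=> kS; exact: bigmin_le_cond. Qed.

Lemma supp_gt0 k : k \in supp gam -> 0 < gam k.
Proof. by rewrite finset.inE => gk; rewrite lt_def gk gam0. Qed.

Lemma gam_min_gt0 k : k \in supp gam -> 0 < gam_min gam.
Proof.
move=> kS; apply: lt_bigmin => [|i iS]; last exact: supp_gt0.
exact: lt_le_trans (supp_gt0 kS) (gam_le_max k).
Qed.

Lemma gam_min_le_max k : k \in supp gam -> gam_min gam <= gam_max gam.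
Proof. by move=> kS; apply: le_trans (gam_min_le kS) (gam_le_max k). Qed.

Lemma sum_gam_le : \sum_k gam k <= #|supp gam|%:R * gam_max gam.
Proof.
rewrite (bigID (mem (supp gam)))/= [X in _ + X]big1 ?addr0; last first.
  by move=> k; rewrite finset.inE negbK => /eqP.
rewrite mulr_natl -sumr_const; apply: ler_sum => k _; exact: gam_le_max.
Qed.

End gam_extrema.

(** [exp (- 1/2) >= 1/2] gives [exp (1/2) <= 2]. *)
Lemma half_le_ln {R : realType} (x : R) : 2 <= x -> 2^-1 <= ln x.
Proof.
move=> x2; rewrite -[leLHS](@expRK R) ler_ln ?posrE ?expR_gt0//; last by lra.
apply: le_trans x2.
have h : expR 2^-1 * expR (- 2^-1) = 1 :> R by rewrite -expRD subrr expR0.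
have := expR_ge1Dx (- 2^-1 : R); have := expR_gt0 (2^-1 : R); nra.
Qed.

Section separation.
Context {R : realType} {d : measure_display} {T : measurableType d} {D N M : nat}
  (sigma : R).
Variables (a : 'I_N -> T -> 'cV[R[i]]_D) (gam : 'I_N -> R).
Hypothesis gam0 : forall k, 0 <= gam k.
Hypothesis N0 : (0 < N)%N.

(** After exchanging the sums, source [n] contributes [D^2] to its own statistic and at most [q] to
    each other one, per unit of [gam n]; the mean over [k] divides the former by [N]. *)
Lemma mean_signal_le (w : T) (q : R) : 0 <= q ->
  (forall k, nsq (a ^~ w) k = D%:R) ->
  (forall k l, k != l -> ipr (a ^~ w) k l ^+ 2 + ipi (a ^~ w) k l ^+ 2 <= q) ->
  N%:R^-1 * (\sum_k signal sigma a gam w k) <=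
  #|supp gam|%:R * gam_max gam * (D%:R ^+ 2 / N%:R + q) + sigma ^+ 2 * D%:R.
Proof.
move=> q0 nw hw.
have NR : 0 < N%:R :> R by rewrite ltr0n.
rewrite ler_pdivrMl//.
rewrite /signal /= big_split/= exchange_big/= 
  [X in _ + X](eq_bigr (fun=> sigma ^+ 2 * D%:R)); last first.
  by move=> k _; rewrite nw.
rewrite sumr_const card_ord -[_ *+ N]mulr_natl mulrDr lerD2r.
apply: (@le_trans _ _ (\sum_n gam n * (D%:R ^+ 2 + N%:R * q))).
  apply: ler_sum => n _; rewrite -mulr_sumr ler_wpM2l//.
  rewrite (bigD1 n)//= lerD//.
    have -> : ipr (a ^~ w) n n = D%:R by rewrite -(nw n); apply: eq_bigr => i _; rewrite !expr2.
    have -> : ipi (a ^~ w) n n = 0 by apply: big1 => i _; rewrite mulrC subrr.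
    by rewrite expr0n addr0.
  apply: (@le_trans _ _ (\sum_(k | k != n) q)).
    by apply: ler_sum => k kn; exact: hw.
  rewrite sumr_const mulr_natl ler_wpMn2l// cardC1 card_ord; exact: leq_pred.
rewrite -mulr_suml.
have -> : N%:R * (#|supp gam|%:R * gam_max gam * (D%:R ^+ 2 / N%:R + q)) =
   #|supp gam|%:R * gam_max gam * (D%:R ^+ 2 + N%:R * q).
  by field; rewrite gt_eqF.
rewrite ler_wpM2r ?sum_gam_le// addr_ge0 ?sqr_ge0// mulr_ge0//.
Qed.

End separation.

(** [G] stands for [gamma_min D^2], [V] for the noise and [m] for the mean of the [s_k]. With the
    slack [2 * (G / 16)] the left side is at most [(1 + dl) (V + 7/32 G)], and the remaining gap of
    [25/32 G] absorbs the terms in [dl]. *)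
Lemma separation_arith {R : realType} (D G V m dl : R) :
  0 < dl <= 8^-1 -> 0 < G -> 0 <= V -> dl * V <= G / 8 ->
  m <= V + 3 / 32 * G ->
  (1 + dl) * (m + 2 * (G / 16)) <= (1 - dl) * (G + V).
Proof.
move=> /andP[d0 d1] G0 V0 hV hm.
have dG : dl * G <= G / 8 by rewrite mulrC ler_wpM2l// ltW.
apply: (@le_trans _ _ ((1 + dl) * (V + 7 / 32 * G))); first by rewrite ler_wpM2l; lra.
nra.
Qed.

Section target.
Context {R : realType} {d : measure_display} {T : measurableType d}
  (P : probability T R) {D N M : nat} (sigma : R).
Variables (a : 'I_N -> T -> 'cV[R[i]]_D) (H : T -> 'M[R[i]]_(N, M))
  (Z : T -> 'M[R[i]]_(D, M)) (gam : 'I_N -> R).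
Hypothesis md : model P sigma a H Z.

Local Notation target := [set w | supp gam \subset
  S0 (fun k => a k w) (obsY gam (fun k => a k w) (H w) (Z w))].

Lemma targetE : target =
  \bigcap_(k in [set` supp gam])
    [set w | N%:R^-1 * (\sum_l stat a H Z gam w l) < stat a H Z gam w k].
Proof.
have E w k : (k \in S0 (fun k => a k w) (obsY gam (fun k => a k w) (H w) (Z w))) =
    (N%:R^-1 * (\sum_l stat a H Z gam w l) < stat a H Z gam w k).
  by rewrite finset.inE Re_natV Re_sum.
apply/seteqP; split=> [w /fintype.subsetP h k /= kS|w h]; first by rewrite -E; exact: h.
by apply/fintype.subsetP => k kS; rewrite E; exact: h.
Qed.

Lemma target_measurable : measurable target.
Proof.
rewrite targetE; apply: fin_bigcap_measurable => // k _.
apply: measurable_set_ltr; last exact: (stat_measurable md).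
apply: measurable_funM => //; apply: measurable_sum => l; exact: (stat_measurable md).
Qed.

End target.

(** * Union bound over the exceptional events *)

Lemma bigsetU_notin {T : Type} (I : finType) (p : pred I) (A : I -> set T) (w : T) i :
  ~ (\big[setU/set0]_(j | p j) A j) w -> p i -> ~ A i w.
Proof. by move=> nA pi Ai; apply: nA; rewrite (bigD1 i)//=; left. Qed.

Section recovery.
Context {R : realType} {d : measure_display} {T : measurableType d}
  (P : probability T R) {D N M : nat} (sigma : R).
Variables (a : 'I_N -> T -> 'cV[R[i]]_D) (H : T -> 'M[R[i]]_(N, M))
  (Z : T -> 'M[R[i]]_(D, M)) (gam : 'I_N -> R).
Hypotheses (D0 : (0 < D)%N) (N0 : (0 < N)%N) (M0 : (0 < M)%N).
Hypothesis md : model P sigma a H Z.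
Hypothesis gam0 : forall k, 0 <= gam k.

Local Notation target := [set w | supp gam \subset
  S0 (fun k => a k w) (obsY gam (fun k => a k w) (H w) (Z w))].

(** Besides null sets, the exceptional events are one upper tail for the mean, one lower tail per
    index of the support, and at most four signed correlations per pair, whence the two counts.
    Outside them [separation_arith] puts the mean strictly below each statistic of the support. *)
Lemma recovery_probability (dl s : R) (k0 : 'I_N) : k0 \in supp gam ->
  0 < dl <= 8^-1 -> dl * sigma ^+ 2 <= gam_min gam / 8 -> 0 <= s ->
  #|supp gam|%:R * gam_max gam * (D%:R ^+ 2 / N%:R + 2 * s ^+ 2 * D%:R) <=
    3 / 32 * (gam_min gam * D%:R ^+ 2) ->
  ((1 - (#|supp gam|.+1%:R * expR (- (M%:R * dl ^+ 2 / 16)) +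
         4 * N%:R ^+ 2 * expR (- (s ^+ 2 / 4))))%:E <= P target)%E.
Proof.
move=> k0S dlb dls s0 hint.
have /andP[dl0 dl8] := dlb.
have dl1 : 0 < dl <= 1 by rewrite dl0; lra.
have DR : 1 <= D%:R :> R by rewrite ler1n.
pose g := gam_min gam.
have g0 : 0 < g by exact: gam_min_gt0 k0S.
pose G := g * D%:R ^+ 2.
have G0 : 0 < G by rewrite mulr_gt0// exprn_gt0//; lra.
pose V := sigma ^+ 2 * D%:R.
have V0 : 0 <= V by rewrite mulr_ge0 ?sqr_ge0.
pose nrm k := [set w | nsq (a ^~ w) k = D%:R].
pose low k := nrm k `&` [set w | stat a H Z gam w k <= (1 - dl) * (G + V)].
pose up := [set w | (1 + dl) * (N%:R^-1 * (\sum_k signal sigma a gam w k) + 2 * (G / 16)) <=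
  N%:R^-1 * \sum_k stat a H Z gam w k].
pose I4 : finType := ('I_N * 'I_N * bool * bool)%type.
pose cor (q : I4) := [set w | s * Num.sqrt (nsq (a ^~ w) q.1.1.2) <
  ip_part a w q.1.1.1 q.1.1.2 q.1.2 q.2].
pose off (q : I4) := q.1.1.1 != q.1.1.2.
pose bad := \big[setU/set0]_(k : 'I_N) ~` nrm k `|`
  (up `|` (\big[setU/set0]_(k in supp gam) low k `|` \big[setU/set0]_(q | off q) cor q)).
have smm := model_sigma_measurable md.
have mstat k : measurable_fun setT (stat a H Z gam ^~ k) := stat_measurable md gam k.
have mnsq k : measurable_fun setT (fun w => nsq (a ^~ w) k).
  exact: (block_measurable_measurable smm (nsq_bmeas k)).
have mnrm k : measurable (nrm k).
  rewrite -[X in measurable X]setTI.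
  exact: (mnsq k measurableT _ (measurable_set1 D%:R)).
have mlow k : measurable (low k).
  apply: measurableI => //; rewrite -[X in measurable X]setTI.
  exact: measurable_fun_le.
have mup : measurable up.
  rewrite -[X in measurable X]setTI; apply: measurable_fun_le => //.
    apply: measurable_funM => //; apply: measurable_funD => //; apply: measurable_funM => //.
    apply: measurable_sum => k.
    exact: (block_measurable_measurable smm (signal_bmeas sigma gam k)).
  by apply: measurable_funM => //; exact: measurable_sum.
have mcor q : measurable (cor q).
  apply: measurable_set_ltr.
    apply: measurable_funM => //; apply: (measurableT_comp measurable_sqrtr).
    exact: mnsq.
  apply: measurable_funM => //; case: q.1.2.
    exact: (block_measurable_measurable smm (ipr_bmeas _ _)).
  exact: (block_measurable_measurable smm (ipi_bmeas _ _)).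
have m1 : measurable (\big[setU/set0]_(k : 'I_N) ~` nrm k).
  by apply: bigsetU_measurable => k _; exact: measurableC.
have m2 : measurable (\big[setU/set0]_(k in supp gam) low k).
  exact: bigsetU_measurable.
have m3 : measurable (\big[setU/set0]_(q | off q) cor q).
  exact: bigsetU_measurable.
have m23 := measurableU _ _ m2 m3.
have mup23 := measurableU _ _ mup m23.
have mbad : measurable bad by exact: measurableU.
set E1 := expR (- (M%:R * _ / _)); set E2 := expR (- (s ^+ 2 / 4)).
have Pbad : (P bad <= (#|supp gam|.+1%:R * E1 + 4 * N%:R ^+ 2 * E2)%:E)%E.
  have Pnrm : P (\big[setU/set0]_(k : 'I_N) ~` nrm k) = 0%E.
    apply/eqP; rewrite eq_le measure_ge0 andbT.
    have := @measure_bigsetU_le _ _ _ P _ (index_enum 'I_N) xpredT (fun k => ~` nrm k).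
    move=> h; apply: le_trans (h _) _ => [k|]; first exact: measurableC.
    rewrite big1// => k _; apply/negligibleP; first exact: measurableC.
    by have := nsq_ae md k; rewrite /almost_everywhere.
  have Pup : (P up <= E1%:E)%E by apply: (mean_upper_tail N0 M0 md gam0) => //; lra.
  have Plow : (P (\big[setU/set0]_(k in supp gam) low k) <= (#|supp gam|%:R * E1)%:E)%E.
    apply: le_trans (measure_bigsetU_le _ _ _ mlow) _.
    apply: (@le_trans _ _ (\sum_(k in supp gam) E1%:E)%E).
      apply: lee_sum => k kS; apply: (stat_lower_tail D0 M0 md gam0) => //.
      by rewrite g0 gam_min_le.
    by rewrite sumEFin sumr_const mulr_natl.
  have Pcor : (P (\big[setU/set0]_(q | off q) cor q) <= (4 * N%:R ^+ 2 * E2)%:E)%E.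
    apply: le_trans (measure_bigsetU_le _ _ _ mcor) _.
    apply: (@le_trans _ _ (\sum_(q | off q) E2%:E)%E).
      by apply: lee_sum => q oq; exact: (pair_tail D0 md).
    rewrite sumEFin lee_fin sumr_const -[leLHS]mulr_natl ler_wpM2r ?expR_ge0//.
    apply: (@le_trans _ _ (#|{: I4}|%:R)); first by rewrite ler_nat max_card.
    rewrite !card_prod card_bool card_ord !natrM le_eqVlt; apply/orP; left.
    by apply/eqP; ring.
  rewrite -natr1 mulrDl mul1r (addrC _ E1) -addrA !EFinD.
  apply: le_trans (measureU2 P m1 mup23) _.
  rewrite -[leRHS]add0e leeD ?Pnrm//.
    by rewrite le_eqVlt; apply/orP; left; exact/eqP.
  apply: le_trans (measureU2 P mup m23) _; rewrite leeD//.
  by apply: le_trans (measureU2 P m2 m3) _; exact: leeD.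
apply: (@le_trans _ _ (P (~` bad))).
  rewrite probability_setC// EFinB leeB//.
apply: le_measure; rewrite ?inE//; [exact: measurableC|exact: target_measurable md|].
move=> w nbad; rewrite targetE => k /= kS.
move: nbad => /not_orP[nn /not_orP[nu /not_orP[nl nc]]].
have nrmw l : nsq (a ^~ w) l = D%:R.
  by have := bigsetU_notin nn (i := l) isT; apply: contra_notP.
have hlow : (1 - dl) * (G + V) < stat a H Z gam w k.
  rewrite ltNge; apply/negP => h.
  by apply: (bigsetU_notin nl kS); split => //; exact: nrmw.
have hup : N%:R^-1 * (\sum_l stat a H Z gam w l) <
    (1 + dl) * (N%:R^-1 * (\sum_k signal sigma a gam w k) + 2 * (G / 16)).
  by rewrite ltNge; apply/negP.
apply: lt_trans hup (le_lt_trans _ hlow).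
apply: separation_arith => //.
  (* From [dls] and [D <= D ^+ 2]. *)
  rewrite /V mulrA /G.
  apply: (@le_trans _ _ (g / 8 * D%:R)); first by rewrite ler_wpM2r.
  have -> : g * D%:R ^+ 2 / 8 = g / 8 * D%:R ^+ 2 by field.
  have g8 : 0 <= g / 8 by rewrite divr_ge0// ltW.
  by rewrite ler_wpM2l// ler_eXnr.
have corw b1 b2 l l' : l != l' -> ip_part a w l l' b1 b2 <= s * Num.sqrt D%:R.
  move=> ll'; rewrite leNgt; apply/negP => h.
  apply: (bigsetU_notin nc (i := (l, l', b1, b2)) ll').
  by rewrite /cor /= nrmw.
(* The real and imaginary parts each have square at most [s ^+ 2 * D], whence the factor two. *)
have q0 : 0 <= 2 * s ^+ 2 * D%:R by rewrite mulr_ge0// mulr_ge0// sqr_ge0.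
apply: le_trans (mean_signal_le sigma gam0 N0 q0 nrmw _) _; last first.
  by rewrite addrC lerD2l.
move=> l l' ll'.
have sqle (x : R) : x <= s * Num.sqrt D%:R -> - x <= s * Num.sqrt D%:R ->
    x ^+ 2 <= s ^+ 2 * D%:R.
  move=> h1 h2; rewrite -[X in _ * X](sqr_sqrtr (ltW (lt_le_trans ltr01 DR))) -exprMn.
  by rewrite -real_normK ?num_real// ler_sqr ?nnegrE ?mulr_ge0// ler_norml lerNl h1 h2.
have := corw true true _ _ ll'; have := corw true false _ _ ll'.
have := corw false true _ _ ll'; have := corw false false _ _ ll'.
rewrite /ip_part !mul1r !mulN1r => i2 i1 r2 r1.
have := sqle _ r1 r2; have := sqle _ i1 i2.
lra.
Qed.

End recovery.

Theorem theorem4 (R : realType) :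
  exists c0 c4 c6 c7 : R, [/\ 0 < c0, 0 < c4, 0 < c6, 0 < c7 &
  forall (D N M : nat) (eps sigma : R) (gam : 'I_N -> R)
    (d : measure_display) (T : measurableType d) (P : probability T R)
    (a : 'I_N -> T -> 'cV[R[i]]_D) (H : T -> 'M[R[i]]_(N, M))
    (Z : T -> 'M[R[i]]_(D, M)),
    (0 < D)%N -> (0 < N)%N -> (0 < M)%N ->
    0 < eps < 1 -> 0 <= sigma ->
    (forall k, 0 <= gam k) ->
    model P sigma a H Z ->
    let K := #|supp gam| in
    let cg := gam_max gam / gam_min gam in
    c4 * (cg * K%:R + sigma ^+ 2 / gam_min gam) ^+ 2
       * ln ((expR 1 * D%:R) ^+ 2 / eps) <= M%:R ->
    K%:R <= Num.min (c6 * D%:R / (cg * ln (D%:R * N%:R))) (c7 * N%:R / cg) ->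
    ((1 - eps - c0 / (D%:R * Num.sqrt D%:R))%:E <=
      P [set w | supp gam \subset
                 S0 (fun k => a k w) (obsY gam (fun k => a k w) (H w) (Z w))])%E].
Proof.
(* The first two come from the failure probability: [4 N^2 exp (- s^2 / 4) = 4 / D^2] and
   [dl^2 / 16 = 1 / (32 x)^2], with [s], [dl] and [x] as below. The other two keep the interference
   within [1/16 + 1/32 = 3/32] of [g * D ^+ 2]. *)
exists 4, (32 ^+ 2), (16^-1 / 32), 16^-1; split.
1-4: by rewrite ?divr_gt0 ?exprn_gt0 ?invr_gt0 ?ltr0n.
move=> D N M eps sigma gam d T P a H Z D0 N0 M0 /andP[eps0 eps1] sg0 gam0 md K cg hM hK.
have DR : 1 <= D%:R :> R by rewrite ler1n.
have NR : 1 <= N%:R :> R by rewrite ler1n.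
have sD0 : 0 < Num.sqrt D%:R :> R by rewrite sqrtr_gt0; lra.
have c0D : 0 <= 4 / (D%:R * Num.sqrt D%:R) :> R.
  by rewrite divr_ge0// mulr_ge0// ltW.
(* Empty support: the inclusion is trivial, while [gam_min] is zero and the ratios by it are
   divisions by zero. *)
have [K0|] := posnP K.
  have -> : [set w | supp gam \subset
      S0 (fun k => a k w) (obsY gam (fun k => a k w) (H w) (Z w))] = setT.
    by rewrite (cards0_eq K0); apply/seteqP; split => // w _; exact: finset.sub0set.
  by rewrite probability_setT lee_fin; lra.
rewrite card_gt0 => /set0Pn[k0 k0S].
have g0 := gam_min_gt0 gam0 k0S; have gG := gam_min_le_max gam0 k0S.
have cg1 : 1 <= cg by rewrite ler_pdivlMr// mul1r.
have K1 : 1 <= K%:R :> R by rewrite ler1n card_gt0; apply/set0Pn; exists k0.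
have gmaxE : gam_max gam = cg * gam_min gam by rewrite divfK// gt_eqF.
set L := ln (D%:R * N%:R) in hK.
move: hK; rewrite le_min => /andP[hK1 hK2].
(* For [L <= 0] the bound on [K] would be nonpositive, against [K >= 1]; this excludes
   [D = N = 1]. *)
have L0 : 0 < L.
  rewrite ltNge; apply/negP => L0.
  have : 16^-1 / 32 * D%:R / (cg * L) <= 0.
    apply: mulr_ge0_le0; first by rewrite mulr_ge0// divr_ge0 ?invr_ge0 ler0n.
    by rewrite invr_le0 mulr_ge0_le0// (le_trans ler01 cg1).
  by move=> h; have := le_trans K1 (le_trans hK1 h); rewrite ler10.
have DN2 : 2 <= D%:R * N%:R :> R.
  rewrite -natrM ler_nat ltnNge; apply/negP => DN1.
  have DN : (D * N)%N = 1%N by apply/eqP; rewrite eqn_leq DN1 muln_gt0 D0 N0.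
  by move: L0; rewrite /L -natrM DN ln1 ltxx.
have L2 : 2^-1 <= L by exact: half_le_ln.
have cgL : 0 < cg * L by rewrite mulr_gt0//; lra.
have {}hK1 : K%:R * (cg * L) <= 16^-1 / 32 * D%:R by rewrite -ler_pdivlMr.
have {}hK2 : K%:R * cg <= 16^-1 * N%:R by rewrite -ler_pdivlMr//; lra.
(* From [cg * L >= 1 / 2] and [hK1]; it lets [(e D)^2] absorb the [K + 1] Gaussian tail events. *)
have KD : K%:R <= D%:R :> R.
  have cgL2 : 2^-1 <= cg * L by apply: le_trans L2 _; rewrite ler_peMl// ltW.
  have KcgL : K%:R * 2^-1 <= K%:R * (cg * L) by rewrite ler_wpM2l.
  lra.
set g := gam_min gam in g0 gG gmaxE hM *.
pose x := cg * K%:R + sigma ^+ 2 / g.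
have sg2 : 0 <= sigma ^+ 2 / g by rewrite divr_ge0 ?sqr_ge0// ltW.
have x1 : 1 <= x by rewrite /x -[leLHS]addr0 lerD// mulr_ege1.
(* [x >= 1] gives [dl <= 1 / 8], and [x >= sigma^2 / g] gives [dl * sigma^2 <= g / 8]. *)
pose dl : R := (8 * x)^-1.
have x0 : 0 < x by lra.
have dlb : 0 < dl <= 8^-1.
  rewrite invr_gt0 mulr_gt0//= lef_pV2 ?posrE//; last by lra.
  lra.
have dls : dl * sigma ^+ 2 <= g / 8.
  rewrite /dl invfM -mulrA (mulrC g) ler_wpM2l ?invr_ge0// ler_pdivrMl//.
  by rewrite -ler_pdivrMr// /x lerDr mulr_ge0// ltW// (lt_le_trans ltr01).
(* Then [s ^+ 2 / 4 = 2 L], so each correlation event has probability at most [1 / (D N)^2]. *)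
pose s : R := Num.sqrt (8 * L).
have s2 : s ^+ 2 = 8 * L by rewrite sqr_sqrtr// mulr_ge0// ltW.
have hint : K%:R * gam_max gam * (D%:R ^+ 2 / N%:R + 2 * s ^+ 2 * D%:R) <=
    3 / 32 * (g * D%:R ^+ 2).
  rewrite gmaxE s2.
  (* Regrouped so that [hK2] bounds the share of each source in its own statistic and [hK1] the
     correlations. *)
  have -> : K%:R * (cg * g) * (D%:R ^+ 2 / N%:R + 2 * (8 * L) * D%:R) =
    g * ((K%:R * cg) * (D%:R ^+ 2 / N%:R) + 16 * D%:R * (K%:R * (cg * L))) by ring.
  have -> : 3 / 32 * (g * D%:R ^+ 2) =
    g * (16^-1 * N%:R * (D%:R ^+ 2 / N%:R) + 16 * D%:R * (16^-1 / 32 * D%:R)).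
    by field; lra.
  apply: ler_wpM2l; first exact: ltW.
  apply: lerD.
    by rewrite ler_wpM2r// divr_ge0 ?sqr_ge0.
  by rewrite ler_wpM2l// mulr_ge0.
apply: le_trans (recovery_probability D0 N0 M0 md gam0 k0S dlb dls (sqrtr_ge0 _) hint).
rewrite lee_fin -addrA lerD2l -opprD lerN2 lerD//.
  (* Gaussian tails: the condition on [M] makes each at most [1 / y], and [(K + 1) / y <= eps]. *)
  set y := (expR 1 * D%:R) ^+ 2 / eps in hM.
  have e2 : 2 <= expR 1 :> R by have := expR_ge1Dx (1 : R); lra.
  (* [K + 1 <= 2 D <= e D <= (e D)^2]. *)
  have eD : K%:R + 1 <= (expR 1 * D%:R) ^+ 2 :> R.
    apply: (@le_trans _ _ (2 * D%:R)); first by rewrite mulr_natl mulr2n lerD.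
    apply: (@le_trans _ _ (expR 1 * D%:R)); first by rewrite ler_wpM2r.
    by rewrite ler_eXnr// (le_trans _ (ler_pM _ _ e2 DR)) ?mulr1 ?ler1n.
  have DR0 : 0 < D%:R :> R by exact: lt_le_trans DR.
  have eD0 : 0 < (expR 1 * D%:R) ^+ 2 :> R by apply/exprn_gt0/mulr_gt0/DR0/expR_gt0.
  have y0 : 0 < y by exact: divr_gt0.
  apply: (@le_trans _ _ (K.+1%:R * y^-1)).
    rewrite ler_wpM2l// -[X in _ <= X^-1](lnK y0) -expRN ler_expR lerN2.
    have -> : M%:R * dl ^+ 2 / 16 = M%:R / (32 ^+ 2 * x ^+ 2) by rewrite /dl; field; lra.
    rewrite ler_pdivlMr ?mulr_gt0 ?exprn_gt0//.
    by rewrite mulrC.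
  rewrite invf_div mulrA ler_pdivrMr//.
  by rewrite mulrC ler_pM2l// -natr1.
(* Correlations: [4 N^2 / (D N)^2 = 4 / D^2], weakened to [4 / (D sqrt D)] by [sqrt D <= D]. *)
rewrite s2.
have -> : expR (- (8 * L / 4)) = ((D%:R * N%:R) ^+ 2)^-1.
  have -> : - (8 * L / 4) = - (2%:R * L) by field.
  by rewrite expRN expRM_natl lnK// posrE; lra.
have -> : 4 * N%:R ^+ 2 * ((D%:R * N%:R) ^+ 2)^-1 = 4 * (D%:R * D%:R)^-1 :> R.
  by field; apply/andP; split; lra.
rewrite ler_wpM2l// lef_pV2 ?posrE ?mulr_gt0//; try lra.
rewrite ler_wpM2l//; rewrite -[leRHS]sqr_sqrtr//.
by rewrite ler_eXnr// -[leLHS]sqrtr1 ler_wsqrtr.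
Qed.
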